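(* Let $G$ be a discrete group and let $f,g \in \mathrm{B}(G)$ be positive definite. Then $$\mathrm{s}(fg)=\inf\{p \in \mathcal{P}(W^{\ast}(G)): \Delta(p) \geqslant \mathrm{s}(f) \otimes \mathrm{s}(g)\},$$ where $\mathcal{P}(W^{\ast}(G))$ is the lattice of projections in $W^{\ast}(G)$.
   Context: For a discrete group $G$, $\mathrm{B}(G)$ is the Fourier--Stieltjes algebra with pointwise multiplication, identified with the dual of the full group $C^*$-algebra $C^*(G)$ via $\langle f,x\rangle=\sum_g f(g)x(g)$, $x\in\mathbb{C}[G]$; positive definite functions correspond to positive functionals. $W^{\ast}(G):=C^*(G)^{**}=\mathrm{B}(G)^*$ is the universal enveloping von Neumann algebra, and elements of $\mathrm{B}(G)$ are its normal functionals. $u_g\in C^*(G)\subset W^*(G)$ denotes the unitary corresponding to $g\in G$. $\Delta: W^{\ast}(G)\to W^{\ast}(G)\otimes W^{\ast}(G)$ (von Neumann algebra tensor product) is the normal $*$-homomorphism determined by $\Delta(u_g)=u_g\otimes u_g$ for $g\in G$; it satisfies $(fg)(x)=(f\otimes g)(\Delta(x))$ for $f,g\in\mathrm{B}(G)$, $x\in W^*(G)$. For positive $\varphi\in \mathrm{B}(G)$, the support $\mathrm{s}(\varphi)$ is the smallest projection $p\in W^*(G)$ such that $\varphi=p\varphi=\varphi p$, where $(x\varphi)(y)=\varphi(yx)$ and $(\varphi x)(y)=\varphi(xy)$. *)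

(* Defs.v *)
From HB Require Import structures.
From mathcomp Require Import all_boot all_order all_algebra complex.
From mathcomp Require Import all_classical all_reals all_analysis.
Set Implicit Arguments.
Unset Strict Implicit.
Unset Printing Implicit Defensive.
Import Order.TTheory GRing.Theory Num.Theory.
Import numFieldNormedType.Exports.
Local Open Scope classical_set_scope.
Local Open Scope ring_scope.

(* Complex Hilbert spaces; [dotp] is linear in its first argument. *)
Record hilbert (R : realType) := Hilbert {
  hilbert_sort :> completeNormedModType R[i];
  dotp : {dot hilbert_sort for (@Num.conj R[i])};
  hilbert_normE : forall v : hilbert_sort, `|v| ^+ 2 = dotp v v }.
Arguments dotp {R h}.

Section Operators.
Context (R : realType).
Implicit Types H : hilbert R.

Definition linear_span H (S : set H) : set H :=
  [set v | exists n (c : 'I_n -> R[i]) (w : 'I_n -> H),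
     (forall i, S (w i)) /\ v = \sum_i c i *: w i].

Definition bounded_op H : set (H -> H) :=
  [set x | linear x /\ continuous x].

Definition is_adjoint H (x y : H -> H) :=
  forall v w, dotp (x v) w = dotp v (y w).

Definition le_op H (x y : H -> H) :=
  forall v, 0 <= dotp (y v - x v) v.

Definition commutant H (S : set (H -> H)) : set (H -> H) :=
  [set x | bounded_op x /\ forall y, S y -> x \o y = y \o x].

(* The von Neumann algebra generated by a set of bounded operators that
   contains the identity and is stable under adjoints. *)
Definition bicommutant H (S : set (H -> H)) : set (H -> H) :=
  commutant (commutant S).

Definition projections H (M : set (H -> H)) : set (H -> H) :=
  [set p | [/\ M p, p \o p = p & is_adjoint p p]].

Definition is_inf H (P S : set (H -> H)) (p : H -> H) :=
  [/\ P p, forall q, S q -> le_op p q &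
      forall r, P r -> (forall q, S q -> le_op r q) -> le_op r p].

(* Normal, i.e. sigma-weakly continuous, linear functionals on M: those of the
   form x |-> \sum_n <x v_n, w_n> with v and w square-summable. *)
Definition normal_functional H (M : set (H -> H)) (F : (H -> H) -> R[i]) :=
  exists v w : nat -> H,
    [/\ cvgn (series (fun n => `|v n| ^+ 2 : R[i]^o)),
        cvgn (series (fun n => `|w n| ^+ 2 : R[i]^o)) &
        forall x, M x ->
          series (fun n => dotp (x (v n)) (w n) : R[i]^o) @ \oo --> (F x : R[i]^o)].

Definition is_support H (M : set (H -> H)) (F : (H -> H) -> R[i])
    (p : H -> H) :=
  let carries q := forall y, M y -> F (y \o q) = F y /\ F (q \o y) = F y in
  [/\ projections M p, carries p &
      forall q, projections M q -> carries q -> le_op p q].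

(* Only the values on M of a map M -> N matter. *)
Definition normal_star_hom H1 H2 (M : set (H1 -> H1)) (N : set (H2 -> H2))
    (D : (H1 -> H1) -> (H2 -> H2)) :=
  [/\ forall x, M x -> N (D x),
      forall (a : R[i]) x y, M x -> M y ->
        D (fun v => a *: x v + y v) = (fun v => a *: D x v + D y v),
      forall x y, M x -> M y -> D (x \o y) = D x \o D y,
      forall x y, M x -> M y -> is_adjoint x y -> is_adjoint (D x) (D y) &
      forall F, normal_functional N F -> normal_functional M (F \o D)].

(* A Hilbert space tensor product of H1 and H2; it is unique up to a unique
   unitary compatible with [tens]. *)
Record hilbert_tensor (H1 H2 : hilbert R) := HilbertTensor {
  tensor_space :> hilbert R;
  tens : {bilinear H1 -> H2 -> tensor_space};
  tens_dotp : forall v v' w w',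
    dotp (tens v w) (tens v' w') = dotp v v' * dotp w w';
  tens_dense :
    dense (linear_span [set t | exists v w, t = tens v w]) }.

(* The unique bounded operator sending [tens v w] to [tens (x v) (y w)],
   for x and y bounded. *)
Definition op_tens H1 H2 (K : hilbert_tensor H1 H2)
    (x : H1 -> H1) (y : H2 -> H2) : K -> K :=
  xget (fun=> 0) [set z : K -> K | bounded_op z /\
    forall v w, z (tens K v w) = tens K (x v) (y w)].
Arguments op_tens {H1 H2} K x y.

Definition vN_tens H1 H2 (K : hilbert_tensor H1 H2)
    (M : set (H1 -> H1)) (N : set (H2 -> H2)) : set (K -> K) :=
  bicommutant [set z | exists x y, [/\ M x, N y & z = op_tens K x y]].
End Operators.
Arguments op_tens {R H1 H2} K x y.
Arguments vN_tens {R H1 H2} K M N.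

Section GroupAlgebras.
Context (R : realType) (G : groupType).
Implicit Types f : G -> R[i].

Definition positive_definite f :=
  forall n (c : 'I_n -> R[i]) (s : 'I_n -> G),
    0 <= \sum_i \sum_j c i * (c j)^* * f ((s j)^-1 * s i)%g.

(* B(G) *)
Definition fourier_stieltjes : set (G -> R[i]) :=
  [set f | exists n (c : 'I_n -> R[i]) (phi : 'I_n -> (G -> R[i])),
     (forall i, positive_definite (phi i)) /\
     (forall s, f s = \sum_i c i * phi i s)].

Definition unitary_rep (H : hilbert R) (u : G -> H -> H) :=
  [/\ forall s, linear (u s),
      forall s v w, dotp (u s v) (u s w) = dotp v w,
      u 1%g = id &
      forall s t, u (s * t)%g = u s \o u t].

(* The universal representation of G (equivalently of C*(G)): the Hilbert space
   direct sum, over all positive definite functions phi, of the cyclic GNS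
   representations of phi. The vector [gns phi] is the cyclic vector of the
   summand of phi; it is unconstrained when phi is not positive definite. These
   axioms determine [urep] and the cyclic vectors up to a unique unitary. *)
Record universal_rep := UniversalRep {
  urep_space :> hilbert R;
  urep : G -> urep_space -> urep_space;
  gns : (G -> R[i]) -> urep_space;
  urep_unitary : unitary_rep urep;
  gns_coef : forall phi, positive_definite phi ->
    forall s, dotp (urep s (gns phi)) (gns phi) = phi s;
  gns_ortho : forall phi psi, positive_definite phi -> positive_definite psi ->
    phi <> psi -> forall s, dotp (urep s (gns phi)) (gns psi) = 0;
  gns_dense : dense (linear_span
    [set v | exists phi s, positive_definite phi /\ v = urep s (gns phi)]) }.

Variable U : universal_rep.

(* W*(G) = C*(G)**, realized as the von Neumann algebra generated by the
   universal representation. *)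
Definition Wstar : set (U -> U) := bicommutant (range (@urep U)).

(* f in B(G) as a normal functional on W*(G); it is unique on W*(G) since the
   span of the u_s is sigma-weakly dense there. *)
Definition functional_of (f : G -> R[i]) : (U -> U) -> R[i] :=
  xget (fun=> 0) [set F : (U -> U) -> R[i] |
    normal_functional Wstar F /\ forall s, F (urep s) = f s].

Definition supp (f : G -> R[i]) : U -> U :=
  xget (fun=> 0) [set p : U -> U | is_support Wstar (functional_of f) p].

Definition is_comultiplication (K : hilbert_tensor U U)
    (Delta : (U -> U) -> (K -> K)) :=
  normal_star_hom Wstar (vN_tens K Wstar Wstar) Delta /\
  forall s, Delta (urep s) = op_tens K (urep s) (urep s).

End GroupAlgebras.
Arguments Wstar {R G} U.
Arguments functional_of {R G} U f.
Arguments supp {R G} U f.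

(* Main.v *)
Require Import Defs.
From HB Require Import structures.
From mathcomp Require Import all_boot all_order all_algebra complex.
From mathcomp Require Import all_classical all_reals all_analysis.
From mathcomp Require Import ring lra.
Set Implicit Arguments.
Unset Strict Implicit.
Unset Printing Implicit Defensive.
Import Order.TTheory GRing.Theory Num.Theory.
Import numFieldNormedType.Exports.
Local Open Scope classical_set_scope.
Local Open Scope ring_scope.

(** Let [xi_f] be the GNS vector of [f], so that [f] is the vector functional of
    [xi_f], and let [s(f)] be the projection onto the closure of [W*(G)' xi_f]; a
    projection [p] of [W*(G)] fixes [xi_f] if and only if [s(f) <= p].

    If [Delta p >= s(f) (x) s(g)], then evaluating at [xi_f (x) xi_g] gives
    [(fg)(p) >= (fg)(1)], whence [s(fg) <= p]. Conversely, let [e = s(fg)], and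
    take [h = T xi_f] and [k = S xi_g] with [T], [S] in [W*(G)']. The coefficients of
    [h] and [k] are dominated by multiples of [f] and [g], so by Schur's product
    theorem the coefficient of [h (x) k] is dominated by a multiple of [fg]; as
    [1 - e] is null for [fg], [Delta e] fixes [h (x) k]. Hence it fixes the range
    of [s(f) (x) s(g)].

    All of this relies on a normal functional [\sum_n <x v_n, w_n>] on [W*(G)] being
    determined by its values on the unitaries. Let [xi] be the GNS vector of
    [\sum_n <u_s v_n, v_n>]. Then [u_s xi |-> u_s v_n] extends to an element [T_n] of
    the commutant, so that [x v_n = T_n (x xi)], and the functional becomes a limit
    of [<x xi, eta_N>] with [eta_N] bounded, where [x xi] is a limit of linear
    combinations of the vectors [u_s xi]. *)

(** * Hilbert space geometry *)

Section InnerProduct.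
Context (R : realType).
Implicit Types (H : hilbert R) (z : R[i]).

Definition re z : R := complex.Re z.
Definition im z : R := complex.Im z.
(** The squared modulus, kept in [R] rather than in [R[i]] so that estimates are real arithmetic. *)
Definition sqn z : R := re z ^+ 2 + im z ^+ 2.

Lemma reD z1 z2 : re (z1 + z2) = re z1 + re z2.
Proof. by case: z1; case: z2. Qed.
Lemma imD z1 z2 : im (z1 + z2) = im z1 + im z2.
Proof. by case: z1; case: z2. Qed.
Lemma reN z : re (- z) = - re z. Proof. by case: z. Qed.
Lemma imN z : im (- z) = - im z. Proof. by case: z. Qed.
Lemma reM z1 z2 : re (z1 * z2) = re z1 * re z2 - im z1 * im z2.
Proof. by case: z1; case: z2. Qed.
Lemma imM z1 z2 : im (z1 * z2) = re z1 * im z2 + im z1 * re z2.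
Proof. by case: z1; case: z2. Qed.
Lemma re_conj z : re (z^* ) = re z. Proof. by case: z. Qed.
Lemma im_conj z : im (z^* ) = - im z. Proof. by case: z. Qed.
Lemma re_real (r : R) : re r%:C%C = r. Proof. by []. Qed.
Lemma im_real (r : R) : im r%:C%C = 0. Proof. by []. Qed.
Lemma re0 : re 0 = 0. Proof. by []. Qed.
Lemma im0 : im 0 = 0. Proof. by []. Qed.
Lemma re1 : re 1 = 1. Proof. by []. Qed.
Lemma im1 : im 1 = 0. Proof. by []. Qed.
Definition reimE := (reD, imD, reN, imN, reM, imM, re_conj, im_conj, re_real,
  im_real, re0, im0, re1, im1).

Lemma complexP z1 z2 : re z1 = re z2 -> im z1 = im z2 -> z1 = z2.
Proof. by case: z1 => a b; case: z2 => c d /= -> ->. Qed.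
Lemma re_sum (I : Type) (r : seq I) (F : I -> R[i]) :
  re (\sum_(i <- r) F i) = \sum_(i <- r) re (F i).
Proof. by elim: r => [|i r IH]; rewrite ?big_nil// !big_cons reD IH. Qed.
Lemma ge0_complex z : (0 <= z) = (im z == 0) && (0 <= re z).
Proof. by case: z => a b; rewrite lecE/= . Qed.

Lemma dotC H (u v : H) : dotp u v = (dotp v u)^*.
Proof. by rewrite hermC expr0 mul1r. Qed.
Lemma dotDl H (u v w : H) : dotp (u + v) w = dotp u w + dotp v w.
Proof. exact: linearDl. Qed.
Lemma dotDr H (u v w : H) : dotp u (v + w) = dotp u v + dotp u w.
Proof. exact: linearDr. Qed.
Lemma dotNl H (u w : H) : dotp (- u) w = - dotp u w.
Proof. exact: linearNl. Qed.
Lemma dotNr H (u w : H) : dotp u (- w) = - dotp u w.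
Proof. exact: linearNr. Qed.
Lemma dotZl H z (u w : H) : dotp (z *: u) w = z * dotp u w.
Proof. exact: linearZl_LR. Qed.
Lemma dotZr H z (u w : H) : dotp u (z *: w) = z^* * dotp u w.
Proof. exact: linearZr_LR. Qed.
Lemma dot0l H (w : H) : dotp 0 w = 0. Proof. exact: linear0l. Qed.
Lemma dot0r H (w : H) : dotp w 0 = 0. Proof. exact: linear0r. Qed.
Definition dotE := (dotDl, dotDr, dotNl, dotNr, dotZl, dotZr, dot0l, dot0r).

(** The squared norm as a real number. It replaces the [R[i]]-valued norm in every estimate below,
    so that no square roots occur. *)
Definition nsq H (v : H) : R := re (dotp v v).

Lemma nsqE H (v : H) : dotp v v = (nsq v)%:C%C.
Proof.
apply: complexP => //; have: im (dotp v v) = - im (dotp v v).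
  by rewrite {1}dotC im_conj.
by rewrite im_real; lra.
Qed.
Lemma nsq_ge0 H (v : H) : 0 <= nsq v.
Proof. by have := dnorm_ge0 (@dotp R H) v; rewrite nsqE ler0c. Qed.
Lemma nsq_eq0 H (v : H) : nsq v = 0 -> v = 0.
Proof.
by move=> v0; apply/eqP; rewrite -(dnorm_eq0 (@dotp R H)) nsqE v0.
Qed.
Lemma nsq_le0 H (v : H) : nsq v <= 0 -> v = 0.
Proof. by move=> v0; apply: nsq_eq0; apply: le_anti; rewrite v0 nsq_ge0. Qed.
Lemma nsqD H (u v : H) : nsq (u + v) = nsq u + nsq v + 2 * re (dotp u v).
Proof. by rewrite /nsq !dotE !reD (dotC v u) re_conj; ring. Qed.
Lemma nsqN H (u : H) : nsq (- u) = nsq u.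
Proof. by rewrite /nsq !dotE opprK. Qed.
Lemma nsqB H (u v : H) : nsq (u - v) = nsq u + nsq v - 2 * re (dotp u v).
Proof. by rewrite nsqD nsqN dotNr reN; ring. Qed.
Lemma nsqZ H z (u : H) : nsq (z *: u) = sqn z * nsq u.
Proof. by rewrite /nsq !dotE nsqE /sqn !reimE; ring. Qed.
Lemma nsq0 H : nsq (0 : H) = 0. Proof. by rewrite /nsq dot0l. Qed.
Lemma nsqBC H (u v : H) : nsq (u - v) = nsq (v - u).
Proof. by rewrite -nsqN opprB. Qed.
Lemma nsqD_le H (u v : H) : nsq (u + v) <= 2 * nsq u + 2 * nsq v.
Proof. by have := nsq_ge0 (u - v); rewrite nsqB nsqD; lra. Qed.
Lemma nsq_norm H (u : H) : `|u| ^+ 2 = (nsq u)%:C%C.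
Proof. by rewrite hilbert_normE nsqE. Qed.
Lemma amgm H (u v : H) : 2 * re (dotp u v) <= nsq u + nsq v.
Proof. by have := nsq_ge0 (u - v); rewrite nsqB; lra. Qed.
(** Apply [amgm] to [u] and [c v], then divide by [c]. This turns operator bounds into the
    hypothesis of [riesz]. *)
Lemma amgmC H (u v : H) (c : R) : 0 < c ->
  2 * re (dotp u v) <= c^-1 * nsq u + c * nsq v.
Proof.
move=> c0; have := amgm u (c%:C%C *: v); rewrite dotZr nsqZ /sqn !reimE => h.
rewrite -(ler_pM2l c0) mulrDr (mulrA c c^-1) mulfV ?gt_eqF// mul1r.
by move: h; rewrite expr0n/=; lra.
Qed.
Lemma dot_ext H (u v : H) : (forall w, dotp w u = dotp w v) -> u = v.
Proof.
move=> h; apply/eqP; rewrite -subr_eq0; apply/eqP/nsq_eq0.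
by rewrite /nsq dotDr dotNr h subrr.
Qed.

Lemma nsq_lt_norm H (u : H) (e : R) : 0 < e ->
  (nsq u < e ^+ 2) = (`|u| < e%:C%C).
Proof.
move=> e0; rewrite -[RHS](ltr_pXn2r (n := 2))// ?nnegrE ?ler0c ?(ltW e0)//.
by rewrite nsq_norm -rmorphXn ltcR.
Qed.

(** Completeness restated with real bounds on [nsq]; a positive radius in [R[i]] has zero imaginary
    part, so nothing is lost. *)
Lemma hilbert_complete H (x : nat -> H) :
  (forall e : R, 0 < e -> exists N : nat, forall n k, (N <= n)%N ->
    (N <= k)%N ->
     nsq (x n - x k) < e) ->
  exists l, forall e : R, 0 < e -> exists N : nat, forall n, (N <= n)%N ->
     nsq (x n - l) < e.
Proof.
move=> cx.
have /cauchy_cvgP/cvg_ex[l xl] : cauchy (x @ \oo).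
  apply: cauchy_exP => e e0.
  have e0' : 0 < re e by move: e0; rewrite ltcE => /andP[].
  have eE : e = (re e)%:C%C.
    by apply: complexP => //; move: e0; rewrite ltcE => /andP[/eqP].
  have [N xN] := cx (re e ^+ 2) (exprn_gt0 2 e0').
  exists (x N); exists N => // n /= Nn.
  by rewrite -ball_normE /= eE -nsq_lt_norm// xN.
exists l => e e0.
have d0 : 0 < Num.sqrt e by rewrite sqrtr_gt0.
have d0' : (0 : R[i]) < (Num.sqrt e)%:C%C by rewrite ltcR.
move/cvgrPdist_lt: xl => /(_ _ d0') [N _ xN]; exists N => n Nn.
have := xN n Nn; rewrite /= -nsq_lt_norm// sqr_sqrtr ?ltW//.
by rewrite nsqBC.
Qed.

End InnerProduct.

(** * The Riesz representation theorem on a subspace *)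

Section Riesz.
Context (R : realType).
Implicit Types (H : hilbert R) (z : R[i]).

Lemma sqn_ge0 z : 0 <= sqn z.
Proof. by rewrite addr_ge0 ?sqr_ge0. Qed.
Lemma sqn_eq0 z : sqn z = 0 -> z = 0.
Proof.
rewrite /sqn => z0; apply: complexP; rewrite !reimE;
  apply/eqP; rewrite -sqrf_eq0; apply/eqP; have := sqr_ge0 (re z);
  have := sqr_ge0 (im z); lra.
Qed.
Lemma sqnM z1 z2 : sqn (z1 * z2) = sqn z1 * sqn z2.
Proof. by rewrite /sqn !reimE; ring. Qed.
Lemma sqnD_le z1 z2 : sqn (z1 + z2) <= 2 * sqn z1 + 2 * sqn z2.
Proof.
rewrite /sqn !reimE; have := sqr_ge0 (re z1 - re z2).
by have := sqr_ge0 (im z1 - im z2); lra.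
Qed.
Lemma sqn_conj z : sqn z^* = sqn z.
Proof. by rewrite /sqn !reimE sqrrN. Qed.
Lemma sqn_real (r : R) : sqn r%:C%C = r ^+ 2.
Proof. by rewrite /sqn !reimE expr0n addr0. Qed.
Lemma sqn_eps z : (forall e : R, 0 < e -> sqn z <= e) -> z = 0.
Proof.
move=> h; apply: sqn_eq0; apply: le_anti; rewrite sqn_ge0 andbT.
by apply/ler_addgt0Pr => e e0; rewrite add0r; apply: h.
Qed.

Lemma cauchy_schwarz H (u v : H) : sqn (dotp u v) <= nsq u * nsq v.
Proof.
have [u0|u0] := eqVneq (nsq u) 0.
  by rewrite (nsq_eq0 u0) dot0l /nsq dot0l re0 /sqn im0 !expr0n /= mul0r addr0.
(* This squared norm equals [nsq u * (nsq u * nsq v - sqn (dotp u v))]. *)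
have := nsq_ge0 ((nsq u)%:C%C *: v - dotp v u *: u).
rewrite nsqB !nsqZ sqn_real !dotE !reimE.
rewrite (dotC v u) sqn_conj !reimE /sqn => h.
have : 0 < nsq u by rewrite lt_neqAle eq_sym u0 nsq_ge0.
move=> u1; rewrite -(ler_pM2l u1); move: h.
set a := re _; set b := im _; set p := nsq u; set q := nsq v.
lra.
Qed.

Definition is_subspace H (V : set H) :=
  V 0 /\ forall a u v, V u -> V v -> V (a *: u + v).
(** Membership in the norm closure of [V]. *)
Definition adherent H (V : set H) (r : H) :=
  forall e : R, 0 < e -> exists2 v, V v & nsq (r - v) < e.
(** Linearity is asked on [V] only, since maps defined by choice on a span are arbitrary outside
    it. *)
Definition linear_on H (T : lmodType R[i]) (V : set H) (l : H -> T) :=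
  forall a u v, V u -> V v -> l (a *: u + v) = a *: l u + l v.

Lemma linear_on0 H (T : lmodType R[i]) (V : set H) (l : H -> T) :
  is_subspace V -> linear_on V l -> l 0 = 0.
Proof.
move=> [V0 _] lV; have := lV 1 _ _ V0 V0; rewrite !scale1r addr0 => h.
by apply: (addIr (l 0)); rewrite -h add0r.
Qed.
Lemma subspaceZ H (V : set H) a u : is_subspace V -> V u -> V (a *: u).
Proof. by move=> [V0 VD] Vu; rewrite -[_ *: _]addr0; apply: VD. Qed.
Lemma subspaceD H (V : set H) u v : is_subspace V -> V u -> V v -> V (u + v).
Proof. by move=> [V0 VD] Vu Vv; rewrite -[u]scale1r; apply: VD. Qed.
Lemma linear_onZ H (T : lmodType R[i]) (V : set H) (l : H -> T) a u :
  is_subspace V -> linear_on V l ->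
  V u -> l (a *: u) = a *: l u.
Proof.
move=> sV lV Vu; rewrite -[_ *: _ in LHS]addr0 lV ?(linear_on0 sV lV) ?addr0//.
by case: sV.
Qed.
Lemma linear_onD H (T : lmodType R[i]) (V : set H) (l : H -> T) u v :
  is_subspace V -> linear_on V l -> V u -> V v -> l (u + v) = l u + l v.
Proof. by move=> sV lV Vu Vv; rewrite -[u in LHS]scale1r lV// scale1r. Qed.

Lemma invS_lt (e : R) : 0 < e -> exists N : nat, forall n, (N <= n)%N ->
   n.+1%:R^-1 < e.
Proof.
move=> e0; have [N _ h] := near_infty_natSinv_lt (PosNum e0).
by exists N => n Nn; apply: h.
Qed.

(* The bound on [l] is equivalent to [|l v| <= sqrt C |v|], up to rescaling [v].
   The vector [r] is the limit of a sequence minimising [nsq v - 2 Re (l v)]. *)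
Lemma riesz H (V : set H) (l : H -> R[i]^o) (C : R) :
  is_subspace V -> linear_on V l ->
  (forall v, V v -> 2 * re (l v) <= nsq v + C) ->
  exists r, [/\ forall v, V v -> l v = dotp v r, adherent V r & nsq r <= C].
Proof.
move=> sV lV lC; pose J v := nsq v - 2 * re (l v).
pose S := [set J v | v in V]; pose m := inf S.
have hS : has_inf S.
  split; first by exists (J 0), 0 => //; case: sV.
  by exists (- C) => _ [v Vv <-]; rewrite /J; have := lC v Vv; lra.
have Jm v : V v -> m <= J v.
  by move=> Vv; apply: ge_inf; [case: hS | exists v].
have /choice [x xP] (n : nat) : exists x, V x /\ J x < m + n.+1%:R^-1.
  have [|_ [v Vv <-] vm] := @inf_adherent _ S n.+1%:R^-1 _ hS.
    by rewrite invr_gt0.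
  by exists v.
(* Parallelogram law: the left side is [2 J (x n) + 2 J (x k) - 4 J] of the midpoint, and [J] is at
   least [m] there. *)
have cx n k : nsq (x n - x k) <= 2 * n.+1%:R^-1 + 2 * k.+1%:R^-1.
  have [Vn Jn] := xP n; have [Vk Jk] := xP k.
  have := Jm _ (subspaceZ (2^-1)%:C%C sV (subspaceD sV Vn Vk)).
  move: Jn Jk; rewrite /J (linear_onZ _ sV lV)//; last exact: subspaceD.
  rewrite (linear_onD sV lV)// nsqZ sqn_real nsqD nsqB /GRing.scale/= !reimE.
  set a := n.+1%:R^-1; set b := k.+1%:R^-1; lra.
have [|r xr] := @hilbert_complete _ _ x.
  move=> e e0; have e4 : 0 < e / 4 by lra.
  have [N hN] := invS_lt e4.
  exists N => n k /hN hn /hN hk; apply: le_lt_trans (cx _ _) _.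
  by move: hn hk; set a := n.+1%:R^-1; set b := k.+1%:R^-1; lra.
have lx v : V v -> l v = dotp v r.
  move=> Vv; apply/eqP; rewrite -subr_eq0; apply/eqP/sqn_eps => e e0.
  (* This step length satisfies [s * nsq v = 1 - s], which keeps the quadratic term of the
     perturbation below its linear term. *)
  pose s := (1 + nsq v)^-1.
  have v0 := nsq_ge0 v; have s1 : 0 < 1 + nsq v by lra.
  have s0 : 0 < s by rewrite invr_gt0.
  have sv : s * nsq v = 1 - s.
    by rewrite /s; have := mulVf (lt0r_neq0 s1); lra.
  have d0 : 0 < s * e / 4 by rewrite !mulr_gt0.
  have [N1 hN1] := invS_lt d0; have [N2 hN2] := xr _ d0.
  pose n := maxn N1 N2.
  have {hN1} hn1 := hN1 n (leq_maxl _ _); have {hN2} hn2 :=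
    hN2 n (leq_maxr _ _).
  pose d := l v - dotp v (x n).
  (* Moving [x n] by [s d^* v] changes [J] by [- s |d|^2 - s^2 |d|^2], while [J (x n)] exceeds the
     infimum by less than [1/(n+1)]. *)
  have sd : s * sqn d <= n.+1%:R^-1.
    have [Vn Jn] := xP n.
    have := Jm _ (subspaceD sV Vn (subspaceZ (s%:C%C * d^*) sV Vv)).
    rewrite /J (linear_onD sV lV)//; last exact: subspaceZ.
    rewrite (linear_onZ _ sV lV)// nsqD nsqZ sqnM sqn_real sqn_conj.
    rewrite dotZr /GRing.scale/=.
    have -> : l v = d + dotp v (x n) by rewrite /d subrK.
    clearbody d; rewrite (dotC (x n) v) !reimE.
    move: Jn; rewrite /J.
    set A := sqn d; have : s ^+ 2 * A * nsq v = s * A * (1 - s).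
      by rewrite -sv; ring.
    have : s * A = s * re d ^+ 2 + s * im d ^+ 2 by rewrite /A /sqn; ring.
    have : s * A * (1 - s) <= s * A.
      have : 0 <= s ^+ 2 * A by rewrite mulr_ge0 ?sqr_ge0 ?sqn_ge0.
      by lra.
    by set iN := n.+1%:R^-1; lra.
  have -> : l v - dotp v r = d + dotp v (x n - r).
    by rewrite /d dotDr dotNr; ring.
  apply: le_trans (sqnD_le _ _) _.
  have h1 := ler_wpM2l (ltW s0) (cauchy_schwarz v (x n - r)).
  have h2 : s * (nsq v * nsq (x n - r)) <= nsq (x n - r).
    by rewrite mulrA sv mulrBl mul1r gerBl mulr_ge0 ?nsq_ge0// ltW.
  rewrite -(ler_pM2l s0) mulrDr; move: hn1 sd.
  by set iN := n.+1%:R^-1; lra.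
exists r; split=> //.
- move=> e e0; have [N hN] := xr _ e0; exists (x N); first by case: (xP N).
  by rewrite nsqBC hN.
- apply/ler_addgt0Pr => e e0; have [N hN] := xr _ e0.
  have [VN _] := xP N; have := lC _ VN; rewrite lx// => h.
  have -> : nsq r = 2 * re (dotp (x N) r) - nsq (x N) + nsq (x N - r).
    by rewrite nsqB; ring.
  by have := hN N (leqnn N); lra.
Qed.

End Riesz.

(** * Bounded operators, adjoints, extensions and orthogonal projections *)

Section Operators.
Context (R : realType).
Implicit Types (H : hilbert R).

Definition bop H (x : H -> H) :=
  linear x /\ exists2 C : R, 0 < C & forall v, nsq (x v) <= C * nsq v.

Section Linear.
Context (H1 H2 : lmodType R[i]) (x : H1 -> H2) (lx : linear x).
Lemma lin0 : x 0 = 0.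
Proof.
have := lx 1 0 0; rewrite !scale1r addr0 => h.
by apply: (addIr (x 0)); rewrite -h add0r.
Qed.
Lemma linD u v : x (u + v) = x u + x v.
Proof. by rewrite -[u in LHS]scale1r lx scale1r. Qed.
Lemma linZ a u : x (a *: u) = a *: x u.
Proof. by rewrite -[a *: u]addr0 lx lin0 addr0. Qed.
Lemma linN u : x (- u) = - x u.
Proof. by rewrite -scaleN1r linZ scaleN1r. Qed.
Lemma linB u v : x (u - v) = x u - x v.
Proof. by rewrite linD linN. Qed.
Lemma lin_sum (I : Type) (r : seq I) (F : I -> H1) :
  x (\sum_(i <- r) F i) = \sum_(i <- r) x (F i).
Proof. by elim: r => [|i r IH]; rewrite ?big_nil ?lin0// !big_cons linD IH. Qed.
End Linear.

Lemma bounded_opP H (x : H -> H) : bounded_op x <-> bop x.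
Proof.
split=> -[lx]; [move=> cx | move=> [C C0 xC]]; split=> //.
  have := cx 0; rewrite /continuous_at (lin0 lx) => /cvgrPdist_lt/(_ 1 ltr01).
  move=> /nbhs_ballP[d /= d0 dP].
  have d0' : 0 < re d by move: d0; rewrite ltcE => /andP[].
  have dE : d = (re d)%:C%C.
    by apply: complexP => //; move: d0; rewrite ltcE => /andP[/eqP].
  have xd v : nsq v < re d ^+ 2 -> nsq (x v) < 1.
    rewrite nsq_lt_norm// -dE => vd.
    have := dP v; rewrite -ball_normE /= sub0r normrN => /(_ vd).
    by rewrite sub0r normrN -nsq_lt_norm ?ltr01// expr1n.
  exists (2 / re d ^+ 2) => [|v]; first by rewrite divr_gt0 ?exprn_gt0.
  have [v0|v0] := eqVneq (nsq v) 0.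
    by rewrite (nsq_eq0 v0) (lin0 lx) nsq0 mulr0.
  have v1 : 0 < nsq v by rewrite lt_neqAle eq_sym v0 nsq_ge0.
  have d2 : 0 < re d ^+ 2 by rewrite exprn_gt0.
  (* With this choice [sqrt t *: v] has squared norm [re d ^+ 2 / 2], hence lies in the ball where
     [nsq (x v) < 1]. *)
  pose t := re d ^+ 2 / (2 * nsq v).
  have t0 : 0 < t by rewrite divr_gt0// mulr_gt0.
  have tv : t * nsq v = re d ^+ 2 / 2.
    by rewrite /t; field.
  have := xd ((Num.sqrt t)%:C%C *: v).
  rewrite (linZ lx) !nsqZ sqn_real sqr_sqrtr; last exact: ltW.
  rewrite tv => /(_ ltac:(lra)) h.
  have -> : 2 / re d ^+ 2 * nsq v = t^-1.
    by rewrite /t; field; rewrite v0 gt_eqF.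
  by rewrite -(ler_pM2l t0) mulfV ?gt_eqF//; exact: ltW.
move=> v; apply/cvgrPdist_lt => e e0.
have e0' : 0 < re e by move: e0; rewrite ltcE => /andP[].
have eE : e = (re e)%:C%C.
  by apply: complexP => //; move: e0; rewrite ltcE => /andP[/eqP].
pose d := Num.sqrt (re e ^+ 2 / C).
have d0 : 0 < d by rewrite sqrtr_gt0 divr_gt0 ?exprn_gt0.
apply/nbhs_ballP; exists d%:C%C => /=; first by rewrite ltcR.
move=> w; rewrite -ball_normE /= -nsq_lt_norm// sqr_sqrtr; last first.
  by rewrite divr_ge0 ?sqr_ge0 ?ltW.
rewrite ltr_pdivlMr// mulrC eE -nsq_lt_norm// -(linB lx).
exact: le_lt_trans (xC _).
Qed.

Lemma adjoint_sym H (x y : H -> H) : is_adjoint x y -> is_adjoint y x.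
Proof. by move=> xy v w; rewrite dotC -xy -dotC. Qed.

Lemma adjoint_linear H (x y : H -> H) : is_adjoint x y -> linear y.
Proof.
move=> xy a u v; apply: dot_ext => w.
by rewrite -xy !dotE !xy.
Qed.

(** [y w] is the Riesz vector of [v |-> dotp (x v) w] on the whole space; the constant [C * nsq w]
    given to [riesz] is also the bound on [y]. *)
Lemma bop_adjoint H (x : H -> H) : bop x -> exists2 y, bop y & is_adjoint x y.
Proof.
move=> [lx [C C0 xC]].
have sT : is_subspace (@setT H) by [].
have /choice[y yP] w : exists r, (forall v, dotp (x v) w = dotp v r) /\
  nsq r <= C * nsq w.
  have [||r [rl _ rC]] := @riesz _ _ _ (fun v => dotp (x v) w) (C * nsq w) sT.
  - by move=> a u v _ _; rewrite lx !dotE.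
  - move=> v _; apply: le_trans (amgmC _ _ C0) _; rewrite lerD2r.
    by rewrite ler_pdivrMl.
  by exists r; split=> // v; rewrite rl.
have xy : is_adjoint x y by move=> v w; case: (yP w).
exists y => //; split; first exact: adjoint_linear xy.
by exists C => // v; case: (yP v).
Qed.

Lemma bop_id H : bop (@id H).
Proof. by split=> //; exists 1 => // v; rewrite mul1r. Qed.

Lemma bop_comp H (x y : H -> H) : bop x -> bop y -> bop (x \o y).
Proof.
move=> [lx [C C0 xC]] [ly [D D0 yD]]; split.
  by move=> a u v /=; rewrite ly lx.
exists (C * D) => [|v /=]; first exact: mulr_gt0.
by apply: le_trans (xC _) _; rewrite -mulrA ler_pM2l.
Qed.

Lemma bop_lincomb H (x y : H -> H) a : bop x -> bop y ->
  bop (fun v => a *: x v + y v).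
Proof.
move=> [lx [C C0 xC]] [ly [D D0 yD]]; split.
  move=> b u v /=; rewrite ly lx !scalerDr !scalerA addrACA; congr (_ + _).
  by rewrite mulrC.
exists (2 * sqn a * C + 2 * D) => [|v /=].
  by rewrite ltr_wpDl// ?mulr_gt0// !mulr_ge0 ?sqn_ge0// ltW.
apply: le_trans (nsqD_le _ _) _; rewrite nsqZ (mulrDl (2 * sqn a * C)) lerD//.
  by rewrite -!mulrA !ler_wpM2l// ?mulr_ge0 ?sqn_ge0.
by rewrite -mulrA ler_wpM2l.
Qed.

Lemma subspace_adherent H (V : set H) : is_subspace V ->
  is_subspace (adherent V).
Proof.
move=> sV; split; first by move=> e e0; exists 0; rewrite ?subr0 ?nsq0//;
  case: sV.
move=> a u v Vu Vv e e0.
have c0 : 0 < 1 + sqn a by have := sqn_ge0 a; lra.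
have e1 : 0 < e / 4 / (1 + sqn a) by rewrite !divr_gt0.
have e2 : 0 < e / 4 by lra.
have [u' Vu' uu'] := Vu _ e1; have [v' Vv' vv'] := Vv _ e2.
exists (a *: u' + v'); first by case: sV => _; apply.
have -> : a *: u + v - (a *: u' + v') = a *: (u - u') + (v - v').
  by rewrite scalerBr opprD addrACA.
apply: le_lt_trans (nsqD_le _ _) _; rewrite nsqZ.
have : sqn a * nsq (u - u') <= e / 4.
  move: uu'; rewrite ltr_pdivlMr// mulrDr mulr1.
  by have := nsq_ge0 (u - u'); lra.
lra.
Qed.

Lemma sub_adherent H (V : set H) v : V v -> adherent V v.
Proof. by move=> Vv e e0; exists v => //; rewrite subrr nsq0. Qed.

Lemma adherent_ortho H (V : set H) r z :
  adherent V r -> (forall v, V v -> dotp v z = 0) -> dotp r z = 0.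
Proof.
move=> Vr Vz; apply: sqn_eps => e e0.
have z0 : 0 < 1 + nsq z by have := nsq_ge0 z; lra.
have e1 : 0 < e / (1 + nsq z) by rewrite divr_gt0.
have [v Vv] := Vr _ e1; rewrite ltr_pdivlMr// => rv.
have -> : dotp r z = dotp (r - v) z by rewrite dotDl dotNl (Vz v)// subr0.
apply: le_trans (cauchy_schwarz _ _) _.
by have := nsq_ge0 (r - v); lra.
Qed.

(** The difference is orthogonal to [V] and adherent to [V], hence orthogonal to itself. *)
Lemma adherent_inj H (V : set H) r s : is_subspace V -> adherent V r ->
  adherent V s -> (forall v, V v -> dotp v r = dotp v s) -> r = s.
Proof.
move=> sV Vr Vs rs; apply/eqP; rewrite -subr_eq0; apply/eqP/nsq_eq0.
have h : dotp (r - s) (r - s) = 0.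
  apply: (@adherent_ortho _ V).
    have [_ h] := subspace_adherent sV.
    by rewrite -scaleN1r addrC; apply: h.
  by move=> v Vv; rewrite dotDr dotNr rs// subrr.
by rewrite /nsq h.
Qed.

(** The Riesz vector of [dotp v r] on [V] obeys the bound, and by [adherent_inj] it is [r]. Thus a
    norm can be bounded by testing against [V] alone. *)
Lemma adherent_nsq_le H (V : set H) (r : H) C : is_subspace V -> adherent V r ->
  (forall v, V v -> 2 * re (dotp v r) <= nsq v + C) -> nsq r <= C.
Proof.
move=> sV Vr rC.
have [|s [rs Vs sC]] := @riesz _ _ V (fun v => dotp v r) C sV _ rC.
  by move=> a u v _ _; rewrite !dotE.
by rewrite (adherent_inj sV Vr Vs).
Qed.

(** The adjoint [S] is built first, from the Riesz vectors of [v |-> dotp (B v) w] on [V], and [T]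
    is its adjoint. As [S] takes values in the closure of [V], [T] kills the orthogonal
    complement. *)
Lemma bounded_extension H (V : set H) (B : H -> H) (C : R) :
  is_subspace V -> linear_on V B -> 0 < C ->
  (forall v, V v -> nsq (B v) <= C * nsq v) ->
  exists T, [/\ bop T, forall v, V v -> T v = B v,
    forall z, (forall v, V v -> dotp v z = 0) -> T z = 0 &
    exists2 S, is_adjoint T S & forall w, adherent V (S w)].
Proof.
move=> sV lB C0 BC.
have /choice[S SP] w : exists r, [/\ forall v, V v -> dotp (B v) w = dotp v r,
    adherent V r & nsq r <= C * nsq w].
  have [||r [rl rV rC]] := @riesz _ _ V (fun v => dotp (B v) w) (C * nsq w) sV.
  - by move=> a u v Vu Vv; rewrite lB// !dotE.
  - move=> v Vv; apply: le_trans (amgmC _ _ C0) _; rewrite lerD2r.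
    by rewrite ler_pdivrMl// BC.
  by exists r.
have SV w : adherent V (S w) by case: (SP w).
have bS : bop S.
  split; last by exists C => // w; case: (SP w).
  move=> a u v; apply: (adherent_inj sV) => //.
    by case: (subspace_adherent sV) => _; apply.
  move=> w Vw; case: (SP (a *: u + v)) => <-// _ _.
  by rewrite !dotE; case: (SP u) => ->// _ _; case: (SP v) => ->.
have [T bT ST] := bop_adjoint bS; exists T; split=> //.
- move=> v Vv; apply: dot_ext => w; rewrite -ST dotC [RHS]dotC; congr (_^* ).
  by case: (SP w) => <-.
- move=> z Vz; apply: dot_ext => w; rewrite -ST dot0r.
  exact: (adherent_ortho (SV w)).
- by exists S => //; exact: adjoint_sym.
Qed.

(** Combinations are lists of coefficient-index pairs, so that adding them is concatenation and
    repeated indices are harmless. *)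
Definition span H (I : Type) (a : I -> H) : set H :=
  [set v | exists c : seq (R[i] * I), v = \sum_(p <- c) p.1 *: a p.2].

Lemma scale_comb H (I : Type) (a : I -> H) z (c : seq (R[i] * I)) :
  \sum_(p <- [seq (z * p.1, p.2) | p <- c]) p.1 *: a p.2
  = z *: \sum_(p <- c) p.1 *: a p.2.
Proof.
rewrite big_map scaler_sumr; apply: eq_bigr => p _ /=.
by rewrite scalerA.
Qed.

Lemma span_subspace H (I : Type) (a : I -> H) : is_subspace (span a).
Proof.
split; first by exists [::]; rewrite big_nil.
move=> z _ _ [c1 ->] [c2 ->]; exists ([seq (z * p.1, p.2) | p <- c1] ++ c2).
by rewrite big_cat scale_comb.
Qed.

Lemma span_gen H (I : Type) (a : I -> H) i : span a (a i).
Proof. by exists [:: (1, i)]; rewrite big_seq1 scale1r. Qed.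

(** Domination makes [a i |-> b i] well defined on the span: if two combinations of [a] agree, their
    difference vanishes, and so does the same combination of [b]. *)
Lemma family_extension H (I : Type) (a b : I -> H) :
  (forall c : seq (R[i] * I),
    nsq (\sum_(p <- c) p.1 *: b p.2) <= nsq (\sum_(p <- c) p.1 *: a p.2)) ->
  exists T, [/\ bop T, forall i, T (a i) = b i,
    forall z, (forall i, dotp (a i) z = 0) -> T z = 0 &
    exists2 S, is_adjoint T S & forall w, adherent (span a) (S w)].
Proof.
move=> ab; have sV := span_subspace a.
(* An arbitrary representation of [z] is chosen; [BE] shows independence of it. The default 0 occurs
   only off the span. *)
pose B z := xget 0 [set w | exists2 c : seq (R[i] * I),
  z = \sum_(p <- c) p.1 *: a p.2 & w = \sum_(p <- c) p.1 *: b p.2].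
have BE (c : seq (R[i] * I)) :
    B (\sum_(p <- c) p.1 *: a p.2) = \sum_(p <- c) p.1 *: b p.2.
  rewrite /B; case: xgetP => [w ->
    [c' E ->]|/(_ (\sum_(p <- c) p.1 *: b p.2)) []];
    last by exists c.
  apply/eqP; rewrite -subr_eq0; apply/eqP/nsq_le0.
  rewrite addrC -scaleN1r -scale_comb -big_cat.
  apply: le_trans (ab _) _.
  by rewrite big_cat /= scale_comb E scaleN1r addNr nsq0.
have lB : linear_on (span a) B.
  move=> z _ _ [c1 ->] [c2 ->].
  by rewrite -scale_comb -big_cat !BE big_cat scale_comb.
have [|T [bT TV T0 TS]] := bounded_extension sV lB (C := 1) ltr01.
  by move=> _ [c ->]; rewrite BE mul1r.
exists T; split=> //.
- move=> i; rewrite TV; last exact: span_gen.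
  by have := BE [:: (1, i)]; rewrite !big_seq1 !scale1r.
- move=> z az; apply: T0 => _ [c ->].
  elim: c => [|p c IH]; first by rewrite big_nil dot0l.
  by rewrite big_cons dotDl dotZl az mulr0 add0r.
Qed.

(** [p w] is the Riesz vector of [v |-> dotp v w] on [V]. *)
Lemma ortho_projection H (V : set H) : is_subspace V -> exists p,
  [/\ bop p, is_adjoint p p, forall v, adherent V v -> p v = v &
      forall v, adherent V (p v)].
Proof.
move=> sV; have /choice[p pP] w : exists r,
    [/\ forall v, V v -> dotp v w = dotp v r, adherent V r & nsq r <= nsq w].
  have [||r [rl rV rC]] := @riesz _ _ V (fun v => dotp v w) (nsq w) sV.
  - by move=> a u v _ _; rewrite !dotE.
  - by move=> v _; exact: amgm.
  by exists r.
have pV w : adherent V (p w) by case: (pP w).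
have pd u w : dotp (p u) w = dotp (p u) (p w).
  apply/eqP; rewrite -subr_eq0 -dotNr -dotDr; apply/eqP.
  apply: (adherent_ortho (pV u)) => v Vv.
  by case: (pP w) => h _ _; rewrite dotDr dotNr h// subrr.
exists p; split=> //.
- split; last by exists 1 => // v; rewrite mul1r; case: (pP v).
  move=> a u v; apply: (adherent_inj sV) => //.
    by case: (subspace_adherent sV) => _; apply.
  move=> w Vw; case: (pP (a *: u + v)) => <-// _ _.
  by rewrite !dotE; case: (pP u) => ->// _ _; case: (pP v) => ->.
- by move=> u w; rewrite pd dotC -pd -dotC.
- move=> v Vv; apply: (adherent_inj sV) => // w Vw.
  by case: (pP v) => ->.
Qed.
End Operators.

(** * Commutants and the universal representation *)

Section Commutant.
Context (R : realType) (H : hilbert R).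
Implicit Types (V : set H) (S : set (H -> H)) (x y T p : H -> H).

Lemma ker_adherent V T : bop T -> (forall v, V v -> T v = 0) ->
  forall r, adherent V r -> T r = 0.
Proof.
move=> bT TV r Vr; have [T' _ TT'] := bop_adjoint bT.
apply: dot_ext => w; rewrite dot0r -(adjoint_sym TT') dotC (adherent_ortho Vr)
  ?rmorph0//.
move=> v Vv.
by rewrite -TT' TV// dot0l.
Qed.

Lemma bop_eq_adherent V x y : bop x -> bop y -> (forall v, V v -> x v = y v) ->
  forall r, adherent V r -> x r = y r.
Proof.
move=> bx bY xy r Vr; apply/eqP; rewrite -subr_eq0 addrC -scaleN1r; apply/eqP.
apply: (ker_adherent (V := V) (T := fun r => -1 *: y r + x r)) => //.
  exact: bop_lincomb.
by move=> v /xy ->; rewrite scaleN1r addNr.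
Qed.

(** Invariance gives [p x p = x p] and [p y p = y p]; the adjoint of the second identity is
    [p x p = p x]. *)
Lemma projection_commute V p x y : bop p -> is_adjoint p p ->
  (forall v, adherent V v -> p v = v) -> (forall v, adherent V (p v)) ->
  bop x -> bop y -> is_adjoint x y ->
  (forall v, V v -> adherent V (x v)) -> (forall v, V v -> adherent V (y v)) ->
  x \o p = p \o x.
Proof.
move=> bp pp pV Vp bx bY xy Vx Vy.
have st z : bop z -> (forall v, V v -> adherent V (z v)) ->
    forall v, p (z (p v)) = z (p v).
  move=> bz Vz v; apply: (bop_eq_adherent (V := V) (x := p \o z)) => //.
    exact: bop_comp.
  by move=> w /Vz /pV.
apply/funext => v /=; apply: dot_ext => w.
rewrite -(st x bx Vx) -pp -(adjoint_sym xy) -pp (st y bY Vy).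
by rewrite (adjoint_sym xy) pp.
Qed.

Lemma commutant_comp S x y : commutant S x -> commutant S y ->
  commutant S (x \o y).
Proof.
move=> [/bounded_opP bx cx] [/bounded_opP bY cy]; split.
  by apply/bounded_opP/bop_comp.
move=> z Sz; apply/funext => v /=.
have /(congr1 (fun f => f v)) /= -> := cy _ Sz.
by have /(congr1 (fun f => f (y v))) /= -> := cx _ Sz.
Qed.

Lemma commutant_id S : commutant S id.
Proof. by split => //; apply/bounded_opP/bop_id. Qed.

Lemma commutant_bop S x : commutant S x -> bop x.
Proof. by case=> /bounded_opP. Qed.

Lemma commutantE S x : commutant S x -> forall y v, S y -> x (y v) = y (x v).
Proof. by case=> _ h y v /h /(congr1 (fun f => f v)). Qed.

Lemma bicommutantS S x : bounded_op x -> S x -> bicommutant S x.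
Proof. by move=> bx Sx; split=> // y [_ /(_ _ Sx)]. Qed.

End Commutant.

(** * Intertwiners and cyclic subspaces of the universal representation *)

Section Representation.
Context (R : realType) (G : groupType) (U : universal_rep R G).
Implicit Types (v w xi : U) (s t : G) (c : seq (R[i] * G)).

Local Notation u := (@urep R G U).
Local Notation M' := (commutant (range u)).

Lemma urep_linear s : linear (u s). Proof. by case: (urep_unitary U). Qed.
Lemma urep_isometry s v w : dotp (u s v) (u s w) = dotp v w.
Proof. by case: (urep_unitary U). Qed.
Lemma urep1 : u 1%g = id. Proof. by case: (urep_unitary U). Qed.
Lemma urepM s t v : u (s * t)%g v = u s (u t v).
Proof. by case: (urep_unitary U) => _ _ _ ->. Qed.
Lemma urep_nsq s v : nsq (u s v) = nsq v.
Proof. by rewrite /nsq urep_isometry. Qed.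
Lemma urep_bop s : bop (u s).
Proof.
by split; [exact: urep_linear|exists 1 => // v; rewrite mul1r urep_nsq].
Qed.
Lemma urep_adjoint s : is_adjoint (u s) (u s^-1%g).
Proof.
move=> v w; rewrite -[RHS](urep_isometry s) -urepM divgg urep1.
by [].
Qed.

Lemma commutant_urepE T : M' T -> forall s v, T (u s v) = u s (T v).
Proof. by move=> /commutantE h s v; apply: h; exists s. Qed.

Lemma commutant_urepI T : bop T -> (forall s v, T (u s v) = u s (T v)) -> M' T.
Proof.
move=> bT TU; split; first exact/bounded_opP.
by move=> _ [s _ <-]; apply/funext => v /=; rewrite TU.
Qed.

(** The set of the [u s] is stable under adjoints, because [u s] has adjoint [u s^-1]. *)
Lemma commutant_adjoint x y : M' x -> bop y -> is_adjoint x y -> M' y.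
Proof.
move=> Mx bY xy; apply: commutant_urepI => // s v; apply: dot_ext => w.
by rewrite -xy -!(adjoint_sym (urep_adjoint s)) -xy commutant_urepE.
Qed.

Lemma Wstar_bop x : Wstar U x -> bop x. Proof. exact: commutant_bop. Qed.
Lemma WstarE x : Wstar U x -> forall T v, M' T -> x (T v) = T (x v).
Proof. exact: commutantE. Qed.
Lemma WstarI x : bop x -> (forall T v, M' T -> x (T v) = T (x v)) -> Wstar U x.
Proof.
move=> bx xT; split; first exact/bounded_opP.
by move=> T MT; apply/funext => v /=; rewrite xT.
Qed.
Lemma Wstar_urep s : Wstar U (u s).
Proof. apply: bicommutantS; [exact/bounded_opP/urep_bop | by exists s]. Qed.

(** The action on [v] of the group algebra element with coefficient list [c]. *)
Definition comb c v : U := \sum_(p <- c) p.1 *: u p.2 v.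
Definition cyclic xi : set U := span (fun s => u s xi).

Lemma comb_commutant T c v : M' T -> T (comb c v) = comb c (T v).
Proof.
move=> MT; have [lT _] := commutant_bop MT.
rewrite /comb (lin_sum lT); apply: eq_bigr => p _.
by rewrite (linZ lT) commutant_urepE.
Qed.
Lemma comb_urep s c v : u s (comb c v) = comb [seq (p.1, s * p.2)%g | p <- c] v.
Proof.
rewrite /comb big_map (lin_sum (urep_linear s)); apply: eq_bigr => p _ /=.
by rewrite (linZ (urep_linear s)) urepM.
Qed.
Lemma cyclic_urep s xi v : cyclic xi v -> cyclic xi (u s v).
Proof. by move=> [c ->]; rewrite comb_urep; eexists. Qed.
Lemma cyclic_self xi : cyclic xi xi.
Proof. by have := span_gen (fun s => u s xi) 1%g; rewrite urep1. Qed.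

(** A Radon-Nikodym principle: the extension of [u s xi |-> u s v] by zero commutes with the
    representation. The location of the range of [S] is recorded for use in [normal_eq0]. *)
Lemma intertwiner xi v : (forall c, nsq (comb c v) <= nsq (comb c xi)) ->
  exists T, [/\ M' T, T xi = v &
    exists2 S, is_adjoint T S & forall w, adherent (cyclic xi) (S w)].
Proof.
move=> hc; have sV : is_subspace (cyclic xi) := span_subspace _.
have [T [bT TV T0 TS]] :=
  family_extension (a := fun s => u s xi) (b := fun s => u s v) hc.
exists T; split=> //; last by have := TV 1%g; rewrite urep1.
apply: commutant_urepI => // s z.
have [p [bp pp pV Vp]] := ortho_projection sV.
(* On the closed cyclic subspace commutation is checked on generators; its orthogonal complement is
   invariant under each [u s], and [T] vanishes there. *)
have [z' zV ->] : exists2 z', forall w, cyclic xi w -> dotp w z' = 0 &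
    z = z' + p z.
  exists (z - p z); last by rewrite subrK.
  move=> w Vw; rewrite dotDr dotNr -pp (pV w) ?subrr//.
  exact: sub_adherent.
rewrite (linD (urep_linear s)) !(linD bT.1) (linD (urep_linear s)).
congr (_ + _); last first.
  apply: (bop_eq_adherent (V := cyclic xi) (x := T \o u s) (y := u s \o T)) =>
    //.
  - exact: bop_comp (urep_bop _).
  - exact: bop_comp (urep_bop _) _.
  - move=> _ [c ->] /=; rewrite -/(comb c xi) comb_urep /comb.
    rewrite !(lin_sum bT.1) (lin_sum (urep_linear s)) big_map.
    apply: eq_bigr => q _ /=.
    by rewrite !(linZ bT.1) (linZ (urep_linear s)) !TV urepM.
have z0 t : dotp (u t xi) z' = 0 by apply/zV/cyclic_urep/cyclic_self.
rewrite (T0 _ z0) (lin0 (urep_linear s)) T0// => t.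
by rewrite -(adjoint_sym (urep_adjoint s)) -urepM.
Qed.

(** The projection [p] onto the closed cyclic subspace lies in the commutant, so
    [x xi = x (p xi) = p (x xi)]. This is the density half of the bicommutant theorem, at a single
    vector. *)
Lemma Wstar_adherent x xi : Wstar U x -> adherent (cyclic xi) (x xi).
Proof.
move=> Wx; have [p [bp pp pV Vp]] := ortho_projection (span_subspace (fun s =>
  u s xi)).
have st s v : cyclic xi v -> adherent (cyclic xi) (u s v).
  by move=> Vv; exact/sub_adherent/cyclic_urep.
have Mp : M' p.
  apply: commutant_urepI => // s v.
  have := projection_commute bp pp pV Vp (urep_bop s) (urep_bop s^-1%g)
    (urep_adjoint s) (st _) (st _).
  by move=> /(congr1 (fun f => f v)).
have -> : x xi = p (x xi) by rewrite -(WstarE Wx)// pV//;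
  exact/sub_adherent/cyclic_self.
exact: Vp.
Qed.

End Representation.

(** * Normal functionals *)

Section Limits.
Context (R : realType).
Implicit Types (a b : nat -> R[i]).

(** Convergence to zero, again with real bounds only. *)
Definition null a := forall e : R, 0 < e -> exists N : nat, forall n,
  (N <= n)%N -> sqn (a n) < e.

Lemma null_ext a b : a =1 b -> null a -> null b.
Proof. by move=> ab na e /na[N h]; exists N => n /h; rewrite ab. Qed.

Lemma null0 : null (fun=> 0).
Proof. by move=> e e0; exists 0%N => n _; rewrite /sqn !reimE expr0n addr0. Qed.

Lemma nullD a b : null a -> null b -> null (fun n => a n + b n).
Proof.
move=> na nb e e0; have e4 : 0 < e / 4 by lra.
have [N1 h1] := na _ e4; have [N2 h2] := nb _ e4; exists (maxn N1 N2) => n.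
rewrite geq_max => /andP[/h1 {}h1 /h2 {}h2].
by have := sqnD_le (a n) (b n); lra.
Qed.

Lemma nullZ z a : null a -> null (fun n => z * a n).
Proof.
move=> na e e0; have z0 : 0 < 1 + sqn z by have := sqn_ge0 z; lra.
have e1 : 0 < e / (1 + sqn z) by rewrite divr_gt0.
have [N h] := na _ e1; exists N => n /h; rewrite sqnM ltr_pdivlMr//.
by have := sqn_ge0 (a n); lra.
Qed.

Lemma null_sum (I : Type) (r : seq I) (z : I -> R[i]) (a : I -> nat -> R[i]) :
  (forall i, null (a i)) -> null (fun n => \sum_(i <- r) z i * a i n).
Proof.
move=> na; elim: r => [|i r IH].
  by apply: null_ext null0 => n; rewrite big_nil.
by apply: null_ext (nullD (nullZ (z i) (na i)) IH) => n; rewrite big_cons.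
Qed.

Lemma null_cst z : null (fun=> z) -> z = 0.
Proof. by move=> nz; apply: sqn_eps => e /nz[N /(_ N (leqnn _))/ltW]. Qed.

Lemma sqn_norm (z : R[i]) (e : R) : 0 < e -> (sqn z < e) = (`|z|
  < (Num.sqrt e)%:C%C).
Proof. by move=> e0; rewrite normc_def ltcR ltr_sqrt. Qed.

Lemma cvg_null (a : nat -> R[i]^o) (l : R[i]^o) : a @ \oo --> l ->
  null (fun n => a n - l).
Proof.
move=> al e e0.
have d0 : (0 : R[i]) < (Num.sqrt e)%:C%C by rewrite ltcR sqrtr_gt0.
move/cvgrPdist_lt: al => /(_ _ d0) [N _ xN]; exists N => n Nn.
by have := xN n Nn; rewrite sqn_norm// distrC.
Qed.

Lemma sqsum_bounded (H : hilbert R) (v : nat -> H) :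
  cvgn (series (fun n => `|v n| ^+ 2 : R[i]^o)) ->
  exists W : R, forall N : nat, \sum_(n < N) nsq (v n) <= W.
Proof.
move=> /cvg_ex[l /cvg_null/(_ 1 ltr01)[N0 hN]].
(* From [N0] on, the partial sums are within 1 of the limit; earlier ones are smaller by
   monotonicity. *)
exists (re l + 1) => N.
have : \sum_(n < N) nsq (v n) <= \sum_(n < maxn N N0) nsq (v n).
  rewrite -!(big_mkord xpredT (fun n => nsq (v n))).
  rewrite (big_cat_nat (leq0n N) (leq_maxl N N0))/= lerDl.
  by apply: sumr_ge0 => i _; exact: nsq_ge0.
move/le_trans; apply; have := hN _ (leq_maxr N N0).
rewrite seriesEord /=.
have -> : \sum_(k < maxn N N0) `|v k|
  ^+ 2 = (\sum_(k < maxn N N0) nsq (v k))%:C%C.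
  by rewrite rmorph_sum; apply: eq_bigr => i _; rewrite nsq_norm.
rewrite /sqn !reimE; set x := \sum_(_ < _) _; have := sqr_ge0 (0 - im l).
move=> h1 h2; have {h2} : (x - re l) ^+ 2 < 1 by lra.
have [|] := ltP x (re l); first by lra.
by nra.
Qed.

Lemma dominated_series (x y : nat -> R) (W : R) : (forall n, `|x n| <= y n) ->
  (forall N : nat, \sum_(n < N) y n <= W) ->
  exists l : R, forall e : R, 0 < e -> exists N : nat, forall n, (N <= n)%N ->
    `|\sum_(k < n) x k - l| < e.
Proof.
move=> xy yW.
have y0 n : 0 <= y n by exact: le_trans (xy n).
have cy : cvgn (series y).
  apply: nondecreasing_is_cvgn.
    by apply/nondecreasing_seqP => n; rewrite seriesSr lerDl.
  by exists W => _ [n _ <-]; rewrite seriesEord; exact: yW.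
have cx : cvgn (series x).
  by apply: normed_cvg; apply: series_le_cvg cy => // n; rewrite normr_ge0.
exists (limn (series x)) => e e0.
move/cvgrPdist_lt: cx => /(_ _ e0) [N _ xN]; exists N => n Nn.
by have := xN n Nn; rewrite /= distrC seriesEord.
Qed.

Lemma dominated_null a (y : nat -> R) (W : R) : (forall n, `|re (a n)|
  <= y n) ->
  (forall n, `|im (a n)| <= y n) ->
  (forall N : nat, \sum_(n < N) y n <= W) ->
  exists z, null (fun N => \sum_(n < N) a n - z).
Proof.
move=> ra ia yW; have [p hp] := dominated_series ra yW.
have [q hq] := dominated_series ia yW.
(* If both errors are below [d], then [d <= 1] makes their squares smaller than [d], hence than
   [e / 2]. *)
exists (p +i* q)%C => e e0; pose d := Num.min 1 (e / 2).
have d0 : 0 < d by rewrite lt_min ltr01 divr_gt0.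
have d1 : d <= 1 by rewrite ge_min lexx.
have d2 : d <= e / 2 by rewrite ge_min lexx orbT.
have [N1 h1] := hp _ d0; have [N2 h2] := hq _ d0; exists (maxn N1 N2) => n.
rewrite geq_max => /andP[/h1 {}h1 /h2 {}h2]; move: h1 h2.
rewrite /sqn !reimE re_sum /= !ltr_norml => /andP[h1 h1'] /andP[h2 h2'].
have -> : im (\sum_(i < n) a i) = \sum_(i < n) im (a i).
  by elim/big_rec2: _ => // i z1 z2 _ <-; rewrite imD.
move: h1 h1' h2 h2'; set x := \sum_(_ < _) re _ ; set y' := \sum_(_ < _) im _.
nra.
Qed.

End Limits.

(** * Positive definiteness as a family of quadratic forms *)

Section PositiveDefinite.
Context (R : realType) (G : groupType).
Implicit Types (f : G -> R[i]) (c : seq (R[i] * G)).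

(** The value of [f] at [c^* c], with [c] read as an element of the group algebra. *)
Definition quad f c : R[i] :=
  \sum_(p <- c) \sum_(q <- c) p.1 * (q.1)^* * f (q.2^-1 * p.2)%g.

Lemma positive_definiteP f : (forall c, 0 <= quad f c) -> positive_definite f.
Proof.
move=> h n c s; have := h [seq (c i, s i) | i <- enum 'I_n].
rewrite /quad big_map big_enum; congr (0 <= _); apply: eq_bigr => i _ /=.
by rewrite big_map big_enum.
Qed.

Lemma quad_comb f1 f2 a b c :
  quad (fun s => a * f1 s + b * f2 s) c = a * quad f1 c + b * quad f2 c.
Proof.
rewrite /quad !mulr_sumr -big_split; apply: eq_bigr => p _ /=.
rewrite !mulr_sumr -big_split; apply: eq_bigr => q _ /=.
ring.
Qed.

Lemma quad_sum (n : nat) (f : nat -> G -> R[i]) c :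
  quad (fun s => \sum_(i < n) f i s) c = \sum_(i < n) quad (f i) c.
Proof.
rewrite /quad [RHS]exchange_big/=; apply: eq_bigr => p _ /=.
rewrite [RHS]exchange_big/=; apply: eq_bigr => q _ /=.
by rewrite mulr_sumr.
Qed.

End PositiveDefinite.

(** * Dominating vectors and uniqueness of normal functionals *)

Section NormalFunctionals.
Context (R : realType).

Lemma dot_suml (H : hilbert R) (I : Type) (r : seq I) (F : I -> H) w :
  dotp (\sum_(i <- r) F i) w = \sum_(i <- r) dotp (F i) w.
Proof.
by elim: r => [|i r IH]; rewrite ?big_nil ?dot0l// !big_cons dotDl IH.
Qed.
Lemma dot_sumr (H : hilbert R) (I : Type) (r : seq I) (F : I -> H) w :
  dotp w (\sum_(i <- r) F i) = \sum_(i <- r) dotp w (F i).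
Proof.
by elim: r => [|i r IH]; rewrite ?big_nil ?dot0r// !big_cons dotDr IH.
Qed.

(** Put [a] and [b] in front of the two sequences. Identities between normal functionals can then be
    reduced to the vanishing of a single one. *)
Lemma normal_vector (H : hilbert R) (M : set (H -> H)) F (a b : H) :
  normal_functional M F -> normal_functional M (fun x => F x + dotp (x a) b).
Proof.
move=> [v [w [cv cw Fx]]].
exists (fun n => if n is m.+1 then v m else a), (fun n =>
  if n is m.+1 then w m else b).
have shift (T : normedModType R[i]) (t : T) (h : nat -> T) (l : T) :
    series h @ \oo --> l ->
    series (fun n => if n is m.+1 then h m else t) @ \oo --> l + t.
  move=> hl; rewrite -cvg_shiftS.
  have -> : [sequence series (fun n => if n is m.+1 then h m else t) n.+1]_n
    = (fun n => series h n + t).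
    apply/funext => n; rewrite /= !seriesEord /= big_ord_recl /= addrC.
    by congr (_ + _).
  by apply: cvgD => //; exact: cvg_cst.
split.
- move/cvg_ex: cv => [l /(@shift (R[i]^o) (`|a| ^+ 2)) h].
  apply/cvg_ex; exists (l + `|a| ^+ 2); apply: cvg_trans h.
  by rewrite [X in series X](_ : _ = fun n => if n is m.+1 then `|v m|
    ^+ 2 else `|a| ^+ 2)//; apply/funext => -[].
- move/cvg_ex: cw => [l /(@shift (R[i]^o) (`|b| ^+ 2)) h].
  apply/cvg_ex; exists (l + `|b| ^+ 2); apply: cvg_trans h.
  by rewrite [X in series X](_ : _ = fun n => if n is m.+1 then `|w m|
    ^+ 2 else `|b| ^+ 2)//; apply/funext => -[].
- move=> x Mx; have /(@shift (R[i]^o) (dotp (x a) b)) h := Fx _ Mx.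
  apply: cvg_trans h.
  by rewrite [X in series X](_ : _ = fun n => if n is m.+1 then dotp (x (v m))
    (w m) else dotp (x a) b)//; apply/funext => -[].
Qed.

Lemma normal_zero (H : hilbert R) (M : set (H -> H)) :
  normal_functional M (fun=> 0).
Proof.
exists (fun=> 0), (fun=> 0).
have s0 (T : normedModType R[i]) : series (fun=> 0 : T) = (fun=> 0).
  by apply/funext => n; rewrite seriesEord/= big1.
split.
- rewrite [X in series X](_ : _ = fun=> 0) ?s0; first exact: is_cvg_cst.
  by apply/funext => n; rewrite normr0 expr0n.
- rewrite [X in series X](_ : _ = fun=> 0) ?s0; first exact: is_cvg_cst.
  by apply/funext => n; rewrite normr0 expr0n.
- move=> x _; rewrite [X in series X](_ : _ = fun=> 0) ?s0;
  first exact: cvg_cst.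
  by apply/funext => n; rewrite dot0r.
Qed.

Lemma normal_vector1 (H : hilbert R) (M : set (H -> H)) (a b : H) :
  normal_functional M (fun x => dotp (x a) b).
Proof.
have := normal_vector a b (normal_zero M).
by congr normal_functional; apply/funext => x; rewrite add0r.
Qed.

Context (G : groupType) (U : universal_rep R G).
Implicit Types (v w xi : U) (s t : G) (c : seq (R[i] * G)).

Local Notation u := (@urep R G U).
Local Notation M' := (commutant (range u)).

Definition coef v s : R[i] := dotp (u s v) v.

(** Unitarity gives [<u_s v, u_t v> = coef v (t^-1 s)]. Comparing coefficients as positive definite
    functions thus amounts to comparing the norms of [comb c]. *)
Lemma quad_coef v c : quad (coef v) c = (nsq (comb c v))%:C%C.
Proof.
rewrite -nsqE /comb dot_suml; apply: eq_bigr => p _.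
rewrite dot_sumr; apply: eq_bigr => q _.
by rewrite dotZl dotZr mulrA /coef urepM (adjoint_sym (urep_adjoint _)).
Qed.

Lemma coef_positive v : positive_definite (coef v).
Proof.
by apply: positive_definiteP => c; rewrite quad_coef ler0c nsq_ge0.
Qed.

Lemma coef_gns f : positive_definite f -> coef (gns U f) = f.
Proof. by move=> fp; apply/funext => s; rewrite /coef gns_coef. Qed.

Lemma re_coef v s : `|re (coef v s)| <= nsq v.
Proof.
have := amgm (u s v) v; have := amgm (u s v) (- v).
rewrite dotNr reN nsqN urep_nsq ler_norml /coef => h1 h2.
by apply/andP; split; lra.
Qed.

Lemma im_coef v s : `|im (coef v s)| <= nsq v.
Proof.
have h a : sqn a = 1 -> 2 * re (a * coef v s) <= 2 * nsq v.
  move=> a1; rewrite -dotZl; apply: le_trans (amgm _ _) _.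
  by rewrite nsqZ a1 urep_nsq; lra.
(* Multiplication by [i] and [-i] turns the imaginary part, up to sign, into a real part. *)
have := h (0 +i* 1)%C; have := h (0 +i* -1)%C.
rewrite /sqn !reM /= => h1 h2.
have {}h1 := h1 ltac:(lra); have {}h2 := h2 ltac:(lra).
rewrite ler_norml; apply/andP; split; lra.
Qed.

(* [xi] is the GNS vector of the sum of the coefficients of the [v n]. *)
Lemma summable_dominated (v : nat -> U) (W : R) :
  (forall N : nat, \sum_(n < N) nsq (v n) <= W) ->
  exists xi, forall c (N : nat),
    \sum_(n < N) nsq (comb c (v n)) <= nsq (comb c xi).
Proof.
move=> vW.
have /choice[phi phiP] s : exists z, null (fun N =>
  \sum_(n < N) coef (v n) s - z).
  exact: dominated_null (fun n => re_coef (v n) s) (fun n =>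
    im_coef (v n) s) vW.
(* [quad] involves finitely many values of the function, so pointwise convergence to [phi]
   suffices. *)
have qN c : null (fun N => (\sum_(n < N) nsq (comb c (v n)))%:C%C - quad phi c).
  have h (p : R[i] * G) : null (fun N => \sum_(q <- c) p.1 * (q.1)^* *
      (\sum_(n < N) coef (v n) (q.2^-1 * p.2)%g - phi (q.2^-1 * p.2)%g)).
    by apply: null_sum.
  have := null_sum c (fun=> 1) h; apply: null_ext => N.
  rewrite rmorph_sum /=.
  under [in RHS]eq_bigr do rewrite -quad_coef.
  rewrite -(quad_sum N (fun n => coef (v n))) /quad -sumrB; apply: eq_bigr =>
    p _.
  rewrite mul1r -sumrB; apply: eq_bigr => q _.
  by rewrite mulrBr.
(* The partial sums increase, so an excess [d] over the limit would persist. *)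
have qre c (N : nat) : \sum_(n < N) nsq (comb c (v n)) <= re (quad phi c).
  rewrite leNgt; apply/negP => lt.
  set d := \sum_(n < N) nsq (comb c (v n)) - re (quad phi c).
  have d0 : 0 < d by rewrite subr_gt0.
  have [N0 hN] := qN c _ (exprn_gt0 2 d0).
  have := hN _ (leq_maxr N N0); rewrite /sqn !reimE.
  have : \sum_(n < N) nsq (comb c (v n)) <= \sum_(n < maxn N N0) nsq (comb c (v
    n)).
    rewrite -!(big_mkord xpredT (fun n => nsq (comb c (v n)))).
    rewrite (big_cat_nat (leq0n N) (leq_maxl N N0))/= lerDl.
    by apply: sumr_ge0 => i _; exact: nsq_ge0.
  set x := \sum_(_ < maxn _ _) _ => h; have := sqr_ge0 (0 - im (quad phi c)).
  move=> h1 h2.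
  have : d ^+ 2 <= (x - re (quad phi c)) ^+ 2.
    by rewrite ler_sqr ?nnegrE /d; lra.
  by lra.
have qim c : im (quad phi c) = 0.
  have : null (fun N : nat => 'i%C * ((im (quad phi c))%:C%C : R[i])).
    move=> e e0; have [N0 hN] := qN c _ e0; exists N0 => n /hN.
    rewrite /sqn !reimE; set x := \sum_(_ < _) _ => h.
    have := sqr_ge0 (x - re (quad phi c)).
    have -> : re 'i%C = 0 :> R by [].
    have -> : im 'i%C = 1 :> R by [].
    lra.
  move=> /null_cst /(congr1 (@im R)); rewrite !reimE.
  have -> : re 'i%C = 0 :> R by [].
  have -> : im 'i%C = 1 :> R by [].
  by lra.
have pphi : positive_definite phi.
  apply: positive_definiteP => c; rewrite ge0_complex qim eqxx /=.
  by have := qre c 0%N; rewrite big_ord0.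
exists (gns U phi) => c N; apply: le_trans (qre c N) _.
by rewrite -[in leLHS](coef_gns pphi) quad_coef.
Qed.

Lemma normal_eq0 F : normal_functional (Wstar U) F -> (forall s, F (u s) = 0) ->
  forall x, Wstar U x -> F x = 0.
Proof.
move=> [v [w [/sqsum_bounded[Wv hv] /sqsum_bounded[W hw] Fx]]] F0 x Wx.
have [xi hxi] := summable_dominated hv.
(* Each single term is dominated by [xi], so [v n] is the image of [xi] under an element of the
   commutant, chosen together with its adjoint. *)
have /choice[T TP] n : exists TS : (U -> U) * (U -> U), [/\ M' TS.1,
  TS.1 xi = v n,
    is_adjoint TS.1 TS.2 & forall w, adherent (cyclic xi) (TS.2 w)].
  have [|T [MT Txi [S TS SV]]] := @intertwiner _ _ U xi (v n).
    move=> c; apply: le_trans (hxi c n.+1); rewrite big_ord_recr /= lerDr.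
    by apply: sumr_ge0 => i _; exact: nsq_ge0.
  by exists (T, S).
have sV : is_subspace (cyclic xi) := span_subspace _.
(* Since [y] commutes with [T n], the [n]-th term [<y T_n xi, w_n>] equals [<y xi, T_n^* w_n>]. *)
pose eta N : U := \sum_(n < N) (T n).2 (w n).
have partial y N : Wstar U y ->
    \sum_(n < N) dotp (y (v n)) (w n) = dotp (y xi) (eta N).
  move=> Wy; rewrite dot_sumr; apply: eq_bigr => n _.
  by have [MT <- TS _] := TP n; rewrite -TS (WstarE Wy).
have etaV N : adherent (cyclic xi) (eta N).
  rewrite /eta; elim/big_rec: _ => [|i z _ Vz].
    exact: (subspace_adherent sV).1.
  rewrite -[X in X + _]scale1r; apply: (subspace_adherent sV).2 => //.
  by have [_ _ _] := TP i; apply.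
(* Test against [comb c xi]: [2 Re <comb c (v n), w n>] is at most the sum of the squared norms, and
   those of the [comb c (v n)] add up to at most [nsq (comb c xi)]. *)
have etaW N : nsq (eta N) <= W.
  apply: (adherent_nsq_le sV (etaV N)) => _ [c ->].
  rewrite -/(comb c xi) dot_sumr re_sum mulr_sumr.
  apply: le_trans (_ : \sum_(n < N) (nsq (comb c (v n)) + nsq (w n)) <= _).
    apply: ler_sum => n _; have [MT <- TS _] := TP n.
    by rewrite -TS comb_commutant//; exact: amgm.
  by rewrite big_split /= lerD ?hxi ?hw.
have F'N y : Wstar U y -> null (fun N => dotp (y xi) (eta N) - F y).
  move=> Wy; apply: null_ext (cvg_null (Fx _ Wy)) => N.
  by rewrite seriesEord /= partial.
have combN c : null (fun N => dotp (comb c xi) (eta N)).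
  apply: null_ext (null_sum c (fun p => p.1) (fun p =>
    F'N _ (Wstar_urep U p.2))).
  move=> N; rewrite /comb dot_suml; apply: eq_bigr => p _.
  by rewrite F0 subr0 dotZl.
apply: sqn_eps => e e0.
have W0 : 0 <= W by have := hw 0%N; rewrite big_ord0.
(* The bound on [eta N] is uniform, so the approximation [comb c xi] of [x xi] can be fixed before
   [N]. The three errors below then sum to at most [10 e / 16]. *)
have e1 : 0 < e / 16 / (1 + W) by rewrite !divr_gt0//; lra.
have [_ [c ->]] := Wstar_adherent xi Wx e1; rewrite ltr_pdivlMr; last by lra.
rewrite -/(comb c xi) => hc; have e8 : 0 < e / 16 by lra.
have [N1 h1] := combN c _ e8; have [N2 h2] := F'N x Wx _ e8.
have {}h1 := h1 _ (leq_maxl N1 N2); have {}h2 := h2 _ (leq_maxr N1 N2).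
move: h1 h2; set N := maxn N1 N2 => h1 h2.
have -> : F x = (dotp (x xi - comb c xi) (eta N) + dotp (comb c xi) (eta N))
    + -1 * (dotp (x xi) (eta N) - F x).
  by rewrite dotDl dotNl; ring.
apply: le_trans (sqnD_le _ _) _; rewrite sqnM.
have -> : sqn (-1 : R[i]) = 1 by rewrite /sqn !reimE; ring.
have := sqnD_le (dotp (x xi - comb c xi) (eta N)) (dotp (comb c xi) (eta N)).
have := cauchy_schwarz (x xi - comb c xi) (eta N).
have := nsq_ge0 (x xi - comb c xi); have := etaW N; have := nsq_ge0 (eta N).
move: hc; set a := nsq (x xi - _); set b := nsq (eta N) => hc b0 bW a0.
have : a * b <= a * W by rewrite ler_wpM2l.
lra.
Qed.

End NormalFunctionals.

(** * Supports *)

Section Projections.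
Context (R : realType) (H : hilbert R).
Implicit Types (p q : H -> H) (v : H).

(** For a projection, [nsq (q v - v)] equals [nsq v - <q v, v>]. *)
Lemma projection_fix q v : q \o q = q -> is_adjoint q q ->
  nsq v <= re (dotp (q v) v) -> q v = v.
Proof.
move=> qq aq h; apply/eqP; rewrite -subr_eq0; apply/eqP/nsq_le0; rewrite nsqB.
have <- : re (dotp (q v) v) = nsq (q v).
  by rewrite /nsq -aq -[q (q v)]/((q \o q) v) qq.
lra.
Qed.

Lemma projection_nsq q v : q \o q = q -> is_adjoint q q ->
  dotp (q v) v = (nsq (q v))%:C%C.
Proof. by move=> qq aq; rewrite -nsqE -aq -[q (q v)]/((q \o q) v) qq. Qed.

Lemma projection_nsq_le q v : q \o q = q -> is_adjoint q q ->
  nsq (q v) <= nsq v.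
Proof.
move=> qq aq; have := nsq_ge0 (q v - v); rewrite nsqB.
have -> : dotp (q v) v = (nsq (q v))%:C%C by exact: projection_nsq.
by rewrite re_real; lra.
Qed.

(** From [q p = p] follows [p q = p] by adjoints, so [<p v, v>] is [nsq (p (q v))], at most
    [nsq (q v)]. *)
Lemma le_op_fixed p q : p \o p = p -> is_adjoint p p -> q \o q = q ->
  is_adjoint q q -> (forall v, q (p v) = p v) -> le_op p q.
Proof.
move=> pp ap qq aq qp v; rewrite dotDl dotNl !projection_nsq//.
have pq w : p (q w) = p w by apply: dot_ext => z; rewrite -!ap -aq qp.
by rewrite -pq -rmorphB ler0c subr_ge0; exact: projection_nsq_le.
Qed.

Lemma le_op_fix p q v : q \o q = q -> is_adjoint q q -> le_op p q -> p v = v ->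
  q v = v.
Proof.
move=> qq aq /(_ v) + pv; rewrite pv dotDl dotNl nsqE ge0_complex => /andP[_].
by rewrite !reimE subr_ge0; exact: projection_fix.
Qed.

End Projections.

(** * The support as the projection onto a closed commutant orbit *)

Section Support.
Context (R : realType) (G : groupType) (U : universal_rep R G).
Implicit Types (v w xi : U) (f g : G -> R[i]) (x p q T : U -> U).

Local Notation u := (@urep R G U).
Local Notation M' := (commutant (range u)).

Definition commutant_orbit xi : set U := [set v | exists2 T, M' T & v = T xi].

Lemma commutant_orbit_subspace xi : is_subspace (commutant_orbit xi).
Proof.
split.
  exists (fun=> 0) => //; apply: commutant_urepI => [|s v];
    last by rewrite (lin0 (urep_linear s)).
  split; first by move=> a v w; rewrite scaler0 addr0.
  by exists 1 => // v; rewrite nsq0 mul1r nsq_ge0.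
move=> a _ _ [T MT ->] [T' MT' ->]; exists (fun v => a *: T v + T' v) => //.
apply: commutant_urepI => [|s v].
  exact: bop_lincomb (commutant_bop MT) (commutant_bop MT').
by rewrite (commutant_urepE MT) (commutant_urepE MT') (linD (urep_linear s))
  (linZ (urep_linear s)).
Qed.

Lemma commutant_orbit_self xi : commutant_orbit xi xi.
Proof. by exists id => //; exact: commutant_id. Qed.

(** [normal_eq0] applied to the difference; this is the form in which uniqueness is mostly used. *)
Lemma normal_vectorE F (a b : U) : normal_functional (Wstar U) F ->
  (forall s, F (u s) = dotp (u s a) b) ->
  forall x, Wstar U x -> F x = dotp (x a) b.
Proof.
move=> nF Fu x Wx; apply/eqP; rewrite -subr_eq0 -dotNr; apply/eqP.
apply: (normal_eq0 (normal_vector a (- b) nF)) => // s.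
by rewrite Fu dotNr subrr.
Qed.

(** The vector functional of the GNS vector shows that the choice in [functional_of] succeeds, and
    uniqueness identifies the chosen functional on [Wstar U]. *)
Lemma functional_ofE f : positive_definite f -> forall x, Wstar U x ->
  functional_of U f x = dotp (x (gns U f)) (gns U f).
Proof.
move=> fp.
have [] : [set F | normal_functional (Wstar U) F /\ forall s, F (u s) = f s]
    (functional_of U f).
  apply: (@xgetPex _ (fun=> 0)); exists (fun x => dotp (x (gns U f)) (gns U f)).
  by split; [exact: normal_vector1|move=> s; rewrite gns_coef].
by move=> nF Fu; apply: normal_vectorE => // s; rewrite Fu gns_coef.
Qed.

(** Taking [y = id] gives [<q xi, xi> = nsq xi], which forces [q xi = xi]. Conversely [q], being
    self-adjoint, is absorbed by either copy of [xi]. *)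
Lemma carriesP f q : positive_definite f -> projections (Wstar U) q ->
  (forall y, Wstar U y -> functional_of U f (y \o q) = functional_of U f y /\
     functional_of U f (q \o y) = functional_of U f y) <->
  q (gns U f) = gns U f.
Proof.
move=> fp [Wq qq aq]; split=> [h|qf y Wy].
  apply: projection_fix => //; have [+ _] := h id (commutant_id _).
  by rewrite !functional_ofE//= ?/nsq => [->|]//; exact: commutant_id.
rewrite !functional_ofE//=; [|exact: commutant_comp|exact: commutant_comp].
by rewrite qf aq qf.
Qed.

Lemma supp_spec f : positive_definite f ->
  [/\ projections (Wstar U) (supp U f), supp U f (gns U f) = gns U f,
    forall q, projections (Wstar U) q -> q (gns U f) = gns U f ->
      le_op (supp U f) q &
    forall v, adherent (commutant_orbit (gns U f)) (supp U f v)].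
Proof.
move=> fp; set xi := gns U f.
have sV := commutant_orbit_subspace xi.
have [p [bp pp pV Vp]] := ortho_projection sV.
have p2 : p \o p = p by apply/funext => v; rewrite /= pV.
have st T : M' T -> forall v, commutant_orbit xi v ->
  adherent (commutant_orbit xi) (T v).
  move=> MT _ [T' MT' ->]; apply: sub_adherent; exists (T \o T') => //.
  exact: commutant_comp.
have Pp : projections (Wstar U) p.
  (* The orbit is invariant under the commutant, which contains adjoints, so [p] commutes with
     it. *)
  split=> //; apply: WstarI => // T v MT.
  have [T' bT' TT'] := bop_adjoint (commutant_bop MT).
  have MT' := commutant_adjoint MT bT' TT'.
  have := projection_commute bp pp pV Vp (commutant_bop MT) bT' TT' (st _ MT)
    (st _ MT').
  by move=> /(congr1 (fun h => h v)).
have pxi : p xi = xi by apply/pV/sub_adherent/commutant_orbit_self.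
(* [q] commutes with the commutant, so fixing [xi] it fixes the whole orbit and its closure. *)
have fix_le q : projections (Wstar U) q -> q xi = xi -> forall v, q (p v) = p v.
  move=> [Wq qq aq] qxi v; apply: (bop_eq_adherent (y := id) (Wstar_bop Wq)
    (bop_id _) _ (Vp v)).
  by move=> _ [T MT ->]; rewrite (WstarE Wq)// qxi.
have sp : is_support (Wstar U) (functional_of U f) (supp U f).
  apply: (@xgetPex _ (fun=> 0)); exists p; split=> //.
    exact/(carriesP fp Pp).
  move=> q Pq /(carriesP fp Pq) qxi; have [Wq qq aq] := Pq.
  by apply: le_op_fixed => //; exact: fix_le.
have [Ps cs ms] := sp; have [Ws ss as_] := Ps.
split=> //.
- exact/(carriesP fp Ps).
- by move=> q Pq qxi; apply: ms => //; exact/(carriesP fp Pq).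
(* By minimality the chosen support lies below [p], so its range lies in that of [p]. *)
- move=> v; have <- : p (supp U f v) = supp U f v => //.
  apply: (le_op_fix (p := supp U f)) => //.
    by apply: ms => //; exact/(carriesP fp Pp).
  by rewrite -[LHS]/((supp U f \o supp U f) v) ss.
Qed.

End Support.

(** * Tensor products and the comultiplication *)

Section Tensor.
Context (R : realType) (H1 H2 : hilbert R) (K : hilbert_tensor H1 H2).
Implicit Types (x : H1 -> H1) (y : H2 -> H2) (v : H1) (w : H2).

Local Notation t := (tens K).

Lemma tens_nsq v w : nsq (t v w) = nsq v * nsq w.
Proof. by rewrite /nsq tens_dotp !nsqE !reimE; ring. Qed.

Lemma tens_adherent (z : K) : adherent (linear_span [set t0 | exists v w,
  t0 = t v w]) z.
Proof.
move=> e e0; have d0 : 0 < Num.sqrt e by rewrite sqrtr_gt0.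
have d0' : (0 : R[i]) < (Num.sqrt e)%:C%C by rewrite ltcR.
have [||v [bv Vv]] := @tens_dense _ _ _ K (ball z (Num.sqrt e)%:C%C).
- by exists z; exact: ballxx.
- exact: ball_open.
exists v => //; move: bv; rewrite -ball_normE /= -nsq_lt_norm// sqr_sqrtr//.
exact: ltW.
Qed.

Lemma tens_ext (x y : K -> K) : bop x -> bop y ->
  (forall v w, x (t v w) = y (t v w)) -> x = y.
Proof.
move=> bx bY xy; apply/funext => z.
apply: (bop_eq_adherent bx bY _ (tens_adherent z)) => _ [n [c [w [tw ->]]]].
rewrite (lin_sum bx.1) (lin_sum bY.1); apply: eq_bigr => i _.
by rewrite (linZ bx.1) (linZ bY.1); have [a [b ->]] := tw i; rewrite xy.
Qed.

Lemma tens_ortho (z : K) : (forall v w, dotp (t v w) z = 0) -> z = 0.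
Proof.
move=> tz; apply: nsq_eq0; rewrite /nsq (adherent_ortho (tens_adherent z))//.
move=> _ [n [c [w [tw ->]]]]; rewrite dot_suml big1// => i _.
by have [a [b E]] := tw i; rewrite dotZl E tz mulr0.
Qed.

(** The norm inequality lets [family_extension] produce an operator with the required values, so the
    choice in [op_tens] is not the default. *)
Lemma op_tensE x y :
  (forall c : seq (R[i] * (H1 * H2)),
    nsq (\sum_(p <- c) p.1 *: t (x p.2.1) (y p.2.2))
    <= nsq (\sum_(p <- c) p.1 *: t p.2.1 p.2.2)) ->
  bop (op_tens K x y) /\ forall v w, op_tens K x y (t v w) = t (x v) (y w).
Proof.
move=> h.
have [T [bT TE _ _]] := family_extension (a := fun p => t p.1 p.2)
  (b := fun p => t (x p.1) (y p.2)) h.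
have [/bounded_opP] : [set z : K -> K | bounded_op z /\
    forall v w, z (t v w) = t (x v) (y w)] (op_tens K x y).
  apply: (@xgetPex _ (fun=> 0)); exists T; split; first exact/bounded_opP.
  by move=> v w; rewrite (TE (v, w)).
by [].
Qed.

Lemma op_tens_isometry x y :
  (forall v v', dotp (x v) (x v') = dotp v v') ->
  (forall w w', dotp (y w) (y w') = dotp w w') ->
  bop (op_tens K x y) /\ forall v w, op_tens K x y (t v w) = t (x v) (y w).
Proof.
move=> hx hy; apply: op_tensE => c; rewrite /nsq !dot_suml.
rewrite le_eqVlt; apply/orP; left; apply/eqP; congr re; apply: eq_bigr => p _.
rewrite !dot_sumr; apply: eq_bigr => q _.
by rewrite !dotZl !dotZr !tens_dotp hx hy.
Qed.

Lemma nsqD_ortho (a b : K) : dotp a b = 0 -> nsq a <= nsq (a + b).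
Proof. by move=> ab; rewrite nsqD ab re0 mulr0 addr0 lerDl nsq_ge0. Qed.

(* Splitting one factor as [p v + (v - p v)] splits the sum into two orthogonal
   parts. *)
Lemma op_tens_projection (p : H1 -> H1) (q : H2 -> H2) :
  p \o p = p -> is_adjoint p p -> q \o q = q -> is_adjoint q q ->
  bop (op_tens K p q) /\ forall v w, op_tens K p q (t v w) = t (p v) (q w).
Proof.
move=> pp ap qq aq; apply: op_tensE => c.
have p2 v : p (p v) = p v by rewrite -[LHS]/((p \o p) v) pp.
have q2 w : q (q w) = q w by rewrite -[LHS]/((q \o q) w) qq.
apply: le_trans (_ : nsq (\sum_(i <- c) i.1 *: t (p i.2.1) i.2.2) <= _).
  have -> : \sum_(i <- c) i.1 *: t (p i.2.1) i.2.2 =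
      \sum_(i <- c) i.1 *: t (p i.2.1) (q i.2.2) +
      \sum_(i <- c) i.1 *: t (p i.2.1) (i.2.2 - q i.2.2).
    rewrite -big_split; apply: eq_bigr => i _ /=.
    by rewrite -scalerDr -linearDr addrC subrK.
  apply: nsqD_ortho; rewrite dot_suml big1// => i _; rewrite dot_sumr big1// =>
    j _.
  by rewrite dotZl dotZr tens_dotp dotDr dotNr !aq q2 subrr !mulr0.
have -> : \sum_(i <- c) i.1 *: t i.2.1 i.2.2 =
    \sum_(i <- c) i.1 *: t (p i.2.1) i.2.2 +
    \sum_(i <- c) i.1 *: t (i.2.1 - p i.2.1) i.2.2.
  rewrite -big_split; apply: eq_bigr => i _ /=.
  by rewrite -scalerDr -linearDl addrC subrK.
apply: nsqD_ortho; rewrite dot_suml big1// => i _; rewrite dot_sumr big1// =>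
  j _.
by rewrite dotZl dotZr tens_dotp dotDr dotNr !ap p2 subrr mul0r !mulr0.
Qed.

(** [t v] multiplies squared norms by [nsq v], so it preserves adherence. With [adherent_tensl],
    orthogonality passes from orbits to their closures, one factor at a time. *)
Lemma adherent_tensr (V : set H2) v r (z : K) : adherent V r ->
  (forall w, V w -> dotp (t v w) z = 0) -> dotp (t v r) z = 0.
Proof.
move=> Vr Vz; apply: (adherent_ortho (V := [set t v w | w in V])); last first.
  by move=> _ [w Vw <-]; exact: Vz.
move=> e e0; have c0 : 0 < 1 + nsq v by have := nsq_ge0 v; lra.
have e1 : 0 < e / (1 + nsq v) by rewrite divr_gt0.
have [w Vw] := Vr _ e1; rewrite ltr_pdivlMr// => h.
exists (t v w); first by exists w.
rewrite -linearBr tens_nsq; have := nsq_ge0 (r - w); lra.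
Qed.

Lemma adherent_tensl (V : set H1) r w (z : K) : adherent V r ->
  (forall v, V v -> dotp (t v w) z = 0) -> dotp (t r w) z = 0.
Proof.
move=> Vr Vz; apply: (adherent_ortho (V := [set t v w | v in V])); last first.
  by move=> _ [v Vv <-]; exact: Vz.
move=> e e0; have c0 : 0 < 1 + nsq w by have := nsq_ge0 w; lra.
have e1 : 0 < e / (1 + nsq w) by rewrite divr_gt0.
have [v Vv] := Vr _ e1; rewrite ltr_pdivlMr// => h.
exists (t v w); first by exists v.
rewrite -linearBl tens_nsq; have := nsq_ge0 (r - v); lra.
Qed.

End Tensor.

(** * Schur products and the two inequalities for the support of a product *)

Section Comultiplication.
Context (R : realType) (G : groupType) (U : universal_rep R G).
Context (K : hilbert_tensor U U).
Implicit Types (f g : G -> R[i]) (c : seq (R[i] * G)).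

Local Notation u := (@urep R G U).
Local Notation M' := (commutant (range u)).
Local Notation t := (tens K).

Lemma positive_definite_ge0 f c : positive_definite f -> 0 <= quad f c.
Proof. by move=> fp; rewrite -(coef_gns U fp) quad_coef ler0c nsq_ge0. Qed.

Lemma positive_definiteD f g : positive_definite f -> positive_definite g ->
  positive_definite (fun s => f s + g s).
Proof.
move=> fp gp; apply: positive_definiteP => c.
have := quad_comb f g 1 1 c; rewrite !mul1r => E.
have -> : (fun s => f s + g s) = (fun s => 1 * f s + 1 * g s).
  by apply/funext => s; rewrite !mul1r.
by rewrite E addr_ge0// positive_definite_ge0.
Qed.

Lemma positive_definiteZ (a : R) f : 0 <= a -> positive_definite f ->
  positive_definite (fun s => a%:C%C * f s).
Proof.
move=> a0 fp; apply: positive_definiteP => c.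
have := quad_comb f f a%:C%C 0 c.
have -> : (fun s => a%:C%C * f s + 0 * f s) = (fun s => a%:C%C * f s).
  by apply/funext => s; rewrite mul0r addr0.
by move=> ->; rewrite mul0r addr0 mulr_ge0 ?ler0c// positive_definite_ge0.
Qed.

(** Schur's product theorem: [f g] is the diagonal coefficient of the tensor of the two GNS vectors,
    so its quadratic form is a squared norm in [K]. *)
Lemma positive_definiteM f g : positive_definite f -> positive_definite g ->
  positive_definite (fun s => f s * g s).
Proof.
move=> fp gp; apply: positive_definiteP => c.
rewrite -{1}(coef_gns U fp) -{1}(coef_gns U gp); set a := gns U f; set b :=
  gns U g.
suff -> : quad (fun s => coef a s * coef b s) c =
    (nsq (\sum_(p <- c) p.1 *: t (u p.2 a) (u p.2 b)))%:C%C.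
  by rewrite ler0c nsq_ge0.
rewrite -nsqE dot_suml; apply: eq_bigr => p _.
rewrite dot_sumr; apply: eq_bigr => q _.
rewrite dotZl dotZr tens_dotp mulrA /coef !urepM.
by rewrite !(adjoint_sym (urep_adjoint _)) !mulrA.
Qed.

(** [T] commutes with the group algebra, so [comb c (T xi)] is [T (comb c xi)], bounded by means of
    the constant of [T]. *)
Lemma coef_dominated T xi : M' T -> exists2 C : R, 0 < C &
  positive_definite (fun s => C%:C%C * coef xi s + -1 * coef (T xi) s).
Proof.
move=> MT; have [_ [C C0 TC]] := commutant_bop MT; exists C => //.
apply: positive_definiteP => c.
rewrite quad_comb !quad_coef -comb_commutant// mulN1r -rmorphM -rmorphB ler0c
  subr_ge0.
exact: TC.
Qed.

Variable Delta : (U -> U) -> (K -> K).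
Hypothesis hDelta : is_comultiplication Delta.

Lemma Delta_normal (z : K) :
  normal_functional (Wstar U) (fun x => dotp (Delta x z) z).
Proof.
have [[_ _ _ _ nD] _] := hDelta.
by have := nD _ (normal_vector1 (vN_tens K (Wstar U) (Wstar U)) z z).
Qed.

Lemma Delta_urep s v w : Delta (u s) (t v w) = t (u s v) (u s w).
Proof.
have [_ ->] := hDelta.
by have [_ ->] := op_tens_isometry K (urep_isometry s) (urep_isometry s).
Qed.

Lemma Delta_coef s v w : dotp (Delta (u s) (t v w))
  (t v w) = coef v s * coef w s.
Proof. by rewrite Delta_urep tens_dotp. Qed.

Lemma Delta_projection p : projections (Wstar U) p ->
  [/\ bop (Delta p), Delta p \o Delta p = Delta p & is_adjoint (Delta p)
    (Delta p)].
Proof.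
move=> [Wp pp ap]; have [[WD _ mD aD _] _] := hDelta; split.
- exact: commutant_bop (WD _ Wp).
- by rewrite -mD// pp.
- exact: aD.
Qed.

Lemma supp_prod_le f g p :
  positive_definite f -> positive_definite g -> projections (Wstar U) p ->
  le_op (op_tens K (supp U f) (supp U g)) (Delta p) ->
  le_op (supp U (fun s => f s * g s)) p.
Proof.
move=> fp gp Pp lep; have fgp := positive_definiteM fp gp.
have [_ _ minfg _] := supp_spec U fgp.
set z := gns U _ in minfg; apply: minfg => //.
have [[Wf sf af] fxi _ _] := supp_spec U fp.
have [[Wg sg ag] gxi _ _] := supp_spec U gp.
pose z' : K := t (gns U f) (gns U g).
(* Both sides are normal and equal [f s * g s] at [u s]. *)
have Dz x : Wstar U x -> dotp (Delta x z') z' = dotp (x z) z.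
  apply: (normal_vectorE (Delta_normal z')) => s.
  by rewrite Delta_coef !coef_gns// gns_coef.
have [Wp pp ap] := Pp; apply: projection_fix => //.
(* At [u 1 = id] this gives [nsq z' = nsq z]; the assumed inequality is then tested at [z'], which
   the tensor of the supports fixes. *)
rewrite -Dz//; have := Dz _ (Wstar_urep U 1%g).
rewrite Delta_urep urep1 -/z' !nsqE => -[<-].
have := lep z'; have [_ ->] := op_tens_projection K sf af sg ag.
by rewrite fxi gxi dotDl dotNl nsqE ge0_complex !reimE subr_ge0 => /andP[_].
Qed.

(* The functional of [h (x) k] is dominated by a multiple of that of [f g]. *)
Lemma Delta_fix_orbit f g e h k : positive_definite f -> positive_definite g ->
  projections (Wstar U) e ->
  e (gns U (fun s => f s * g s)) = gns U (fun s => f s * g s) ->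
  commutant_orbit (gns U f) h -> commutant_orbit (gns U g) k ->
  Delta e (t h k) = t h k.
Proof.
move=> fp gp Pe ez [T MT hE] [S MS kE].
have fgp := positive_definiteM fp gp; set z := gns U _ in ez.
have [C C0 /[!coef_gns]// Cp] := coef_dominated (gns U f) MT.
have [D D0 /[!coef_gns]// Dp] := coef_dominated (gns U g) MS.
rewrite -hE in Cp; rewrite -kE in Dp.
(* With [a] and [b] the coefficients of [h] and [k], write [C D f g - a b = (C f - a) (D g) + a (D g
   - b)]. Both products are positive definite by Schur. *)
have chi1 := positive_definiteM Cp (positive_definiteZ (ltW D0) gp).
have chi2 := positive_definiteM (coef_positive h) Dp.
have := positive_definiteD chi1 chi2; set chi := fun s => _ => chiP.
have := positive_definiteM (coef_positive h) (coef_positive k).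
set rho := fun s => _ => rhoP.
pose y := gns U chi; pose a := gns U rho; pose CD : R[i] := - (C * D)%:C%C.
(* The identity [chi + rho = C D f g], carried from the group to [Wstar U]; [CD] holds the negative
   sign. *)
have F0 x : Wstar U x -> dotp (x y) y + dotp (x a) a + dotp (x (CD *: z)) z = 0.
  apply: (normal_eq0 (normal_vector (CD *: z) z
    (normal_vector a a (normal_vector1 (Wstar U) y y)))) => s.
  rewrite (linZ (urep_linear s)) dotZl !gns_coef// /CD /chi /rho rmorphM.
  ring.
have [We ee ae] := Pe.
have ra x : Wstar U x -> dotp (Delta x (t h k)) (t h k) = dotp (x a) a.
  apply: (normal_vectorE (Delta_normal (t h k))) => s.
  by rewrite Delta_coef gns_coef.
have [bD DD aD] := Delta_projection Pe.
apply: projection_fix => //; rewrite ra//.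
have := ra _ (Wstar_urep U 1%g); rewrite Delta_urep urep1 !nsqE => -[->].
(* Compare the values at [e] and at the identity. The [z] terms cancel because [e z = z]; since
   [<e y, y> <= nsq y], it follows that [<e a, a> >= nsq a]. *)
have := F0 _ We; have := F0 _ (Wstar_urep U 1%g); rewrite urep1 => <-.
rewrite (linZ (Wstar_bop We).1) ez => /addIr /(congr1 (@re R)).
rewrite !reD (projection_nsq y)// re_real -!/(nsq _).
by have := projection_nsq_le y ee ae; lra.
Qed.

Lemma le_supp_prod f g : positive_definite f -> positive_definite g ->
  le_op (op_tens K (supp U f) (supp U g)) (Delta (supp U (fun s => f s * g s))).
Proof.
move=> fp gp; have fgp := positive_definiteM fp gp.
have [Pe ez _ _] := supp_spec U fgp; set e := supp U _ in Pe ez *.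
have [[Wf sf af] _ _ Vf] := supp_spec U fp.
have [[Wg sg ag] _ _ Vg] := supp_spec U gp.
have [bE EE] := op_tens_projection K sf af sg ag; set E :=
  op_tens _ _ _ in bE EE *.
have [bD DD aD] := Delta_projection Pe.
(* It suffices to treat elementary tensors. Against any [z], the claim says that [Delta e z - z] is
   orthogonal to the range of [E], which is checked on tensors of orbit vectors. *)
have DE : Delta e \o E = E.
  apply: tens_ext => //; first exact: bop_comp.
  move=> v w /=; rewrite EE; apply: dot_ext => z.
  rewrite -aD; apply/eqP; rewrite -subr_eq0 -dotNl -dotDl dotC; apply/eqP.
  rewrite (adherent_tensl (Vf v)) ?rmorph0// => h Vh.
  apply: (adherent_tensr (Vg w)) => k Vk.
  by rewrite dotDr dotNr -aD (Delta_fix_orbit fp gp Pe ez Vh Vk) subrr.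
have E2 : E \o E = E.
  apply: tens_ext => //; first exact: bop_comp.
  move=> v w /=; rewrite !EE.
  by congr (t _ _); [exact: (congr1 (@^~ v) sf)|exact: (congr1 (@^~ w) sg)].
have aE : is_adjoint E E.
  have [E' bE' EE'] := bop_adjoint bE.
  suff E'E : E' = E by move: EE'; rewrite E'E.
  apply: tens_ext => // v w; apply/eqP; rewrite -subr_eq0; apply/eqP/tens_ortho.
  move=> v' w'; rewrite dotDr dotNr -EE' !EE !tens_dotp.
  by rewrite af ag subrr.
apply: le_op_fixed => // z.
by rewrite -[LHS]/((Delta e \o E) z) DE.
Qed.

End Comultiplication.

Theorem proposition4p23 (R : realType) (G : groupType)
    (U : universal_rep R G) (K : hilbert_tensor U U)
    (Delta : (U -> U) -> (K -> K)) (hDelta : is_comultiplication Delta)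
    (f g : G -> R[i])
    (fB : fourier_stieltjes f) (gB : fourier_stieltjes g)
    (fpos : positive_definite f) (gpos : positive_definite g) :
  is_inf (projections (Wstar U))
    [set p | projections (Wstar U) p /\
             le_op (op_tens K (supp U f) (supp U g)) (Delta p)]
    (supp U (fun s => f s * g s)).
Proof.
have [Pe _ _ _] := supp_spec U (positive_definiteM K fpos gpos).
split=> //.
- by move=> p [Pp lep]; exact: (supp_prod_le hDelta fpos gpos).
(* The infimum is attained: the support of the product is itself in the set. *)
- by move=> r _ ler; apply: ler; split => //; exact: le_supp_prod.
Qed.
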